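(* Let $\widetilde\Gamma(x)=\frac1x e^{x\log 2}\prod_{k=1}^\infty\left(e^{-x/k}(1+x/k)\right)^{(-1)^{k+1}}$. For $\mathrm{Re}(x)>0$, $$\widetilde\Gamma(2x)=\frac{\sqrt\pi}{2}\cdot\frac{\Gamma(x)}{\Gamma\!\left(x+\frac12\right)},$$ and, for every odd positive integer $n$, $$\widetilde\Gamma(nx)=\frac1{\sqrt n}\prod_{j=0}^{n-1}\widetilde\Gamma\!\left(x+\frac jn\right)^{(-1)^j}.$$
   Context: $\Gamma$ is Euler's gamma function. In the product defining $\widetilde\Gamma$, for odd $k$ the factor is $e^{-x/k}(1+x/k)$ and for even $k$ it is its reciprocal. *)

(* Defs.v *)
From HB Require Import structures.
From mathcomp Require Import all_boot all_order all_algebra.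
From mathcomp Require Import complex.
From mathcomp Require Import all_classical all_reals all_analysis.

Set Implicit Arguments.
Unset Strict Implicit.
Unset Printing Implicit Defensive.

Import Order.TTheory GRing.Theory Num.Theory.
Import numFieldNormedType.Exports.

Local Open Scope classical_set_scope.
Local Open Scope ring_scope.
Local Open Scope complex_scope.

Definition cexp (R : realType) (z : R[i]) : R[i] :=
  (expR (complex.Re z))%:C
  * (cos (complex.Im z) +i* sin (complex.Im z)).

(* The integrand t^(x-1) e^(-t) of Euler's integral of the second kind, for
   real t > 0, where t^s means exp (s log t). *)
Definition Gamma_integrand (R : realType) (x : R[i]) (t : R) : R[i] :=
  cexp ((x - 1) * (ln t)%:C) * (expR (- t))%:C.

(* Euler's integral over ]0, +oo[, as a Lebesgue integral taken on real and
   imaginary parts. It is meaningful for Re x > 0 only: no analytic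
   continuation to Re x <= 0 is attempted. *)
Definition Gamma (R : realType) (x : R[i]) : R[i] :=
  (\int[lebesgue_measure]_(t in `]0%R, +oo[) complex.Re (Gamma_integrand x t))
  +i*
  (\int[lebesgue_measure]_(t in `]0%R, +oo[) complex.Im (Gamma_integrand x t)).

(* The exponent (-1) ^+ k.+1 is an integer, so that even k contribute
   reciprocals. *)
Definition Gammat_partial (R : realType) (x : R[i]) (N : nat) : R[i] :=
  \prod_(1 <= k < N.+1)
    (cexp (- x / k%:R) * (1 + x / k%:R)) ^ ((-1) ^+ k.+1 : int).

(* R[i]^o is R[i] with the topology of the complex modulus. *)
Definition Gammat (R : realType) (x : R[i]) : R[i] :=
  x^-1 * cexp (x * (ln 2)%:C) * lim ((Gammat_partial x : nat -> R[i]^o) @ \oo).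

(* Main.v *)
(* Pairing consecutive factors, the product over k <= 2M equals, up to the
   convergence factors e^(-x/k) (whose exponents add up to -x log 2 in the limit),
   x A_M(x) c_M with A_M(x) = prod_{k <= 2M} (x + k)^((-1)^(k+1)) and
   c_M = (2M+1) A_M(1). The functional equation of Gamma writes A_M(x) as
   Gamma(x/2) / (2 Gamma(x/2 + 1/2)) times a ratio Gamma(M + x/2 + 1/2) /
   Gamma(M + 1 + x/2), and Gamma(N + z) ~ (N - 1)! N^z shows that
   sqrt(M+1) A_M(x) converges to that constant; at x = 1 this is Wallis' formula.
   The asymptotics of Gamma(N + z) express that T / N is concentrated at 1 when T
   has the gamma distribution with density t^(N-1) e^(-t) / (N-1)!. Finally,
   splitting k by residues mod n turns A_{nM+p}(nx), n = 2p + 1, into a product of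
   A_M(x + j/n)^((-1)^j), which gives the multiplication formula in the limit. *)

Require Import Defs.
From mathcomp Require Import all_boot all_order all_algebra.
From mathcomp Require Import complex.
From mathcomp Require Import all_classical all_reals all_analysis.
From mathcomp Require Import measurable_realfun.
From mathcomp Require Import zify ring lra.

Import Order.TTheory GRing.Theory Num.Theory.
Import numFieldNormedType.Exports.

Set Implicit Arguments.
Unset Strict Implicit.
Unset Printing Implicit Defensive.

Local Open Scope ring_scope.
Local Open Scope complex_scope.

(** * The fundamental theorem of calculus on ]0, +oo[ *)

Section FTC_pos.
Local Open Scope classical_set_scope.
Variable R : realType.
Local Notation mu := (@lebesgue_measure R).
Local Notation pos_itv := `](0 : R), +oo[.
Implicit Types (f F h H : R -> R) (A B : R).

Lemma measurable_pos_itv : measurable pos_itv.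
Proof. exact: measurable_itv. Qed.

Lemma continuous_measurable_pos f :
  (forall t : R, 0 < t -> {for t, continuous f}) -> measurable_fun pos_itv f.
Proof.
move=> cf; apply: open_continuous_measurable_fun; first exact: interval_open.
by move=> t; rewrite inE/= in_itv/= andbT; exact: cf.
Qed.

(** The intervals [1/(n+1), +oo[ exhaust ]0, +oo[. On each of them the integral is B - F(1/(n+1)),
    and monotone convergence passes to the limit. Only the limit of [F] at 0 is prescribed, because
    integrands such as t^(s-1) may blow up there. *)
Lemma ge0_FTC_pos f F A B :
  (forall t : R, 0 < t -> 0 <= f t) ->
  (forall t : R, 0 < t -> {for t, continuous f}) ->
  (forall t : R, 0 < t -> is_derive t 1 F (f t)) ->
  (F t @[t --> 0^'+] --> A) -> (F t @[t --> +oo] --> B) ->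
  (\int[mu]_(t in pos_itv) (f t)%:E)%E = (B - A)%:E.
Proof.
move=> f0 cf dF FA FB.
pose E n : set R := `[n.+1%:R^-1, +oo[.
have EU : pos_itv = \bigcup_n E n.
  apply/seteqP; split => t /=; rewrite in_itv/= andbT.
    move=> t0; exists (Num.truncn t^-1) => //; rewrite /E/= in_itv/= andbT.
    rewrite -[leRHS]invrK lef_pV2 ?posrE ?invr_gt0//.
    by rewrite ltW// truncnS_gt.
  by case=> n _; rewrite /E/= in_itv/= andbT; apply: lt_le_trans; rewrite invr_gt0.
have Epos n t : E n t -> 0 < t.
  by rewrite /E/= in_itv/= andbT; apply: lt_le_trans; rewrite invr_gt0.
have iE n : (\int[mu]_(t in E n) (f t)%:E)%E = (B - F n.+1%:R^-1)%:E.
  have n0 : 0 < n.+1%:R^-1 :> R by rewrite invr_gt0.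
  rewrite (@ge0_continuous_FTC2y _ f F _ B)//.
  - by move=> t nt; apply: f0; exact: lt_le_trans nt.
  - apply: continuous_in_subspaceT => t; rewrite inE => /Epos; exact: cf.
  - by move=> t nt; case: (dF t (lt_trans n0 nt)).
  - apply: cvg_at_right_filter; apply: differentiable_continuous.
    by apply/derivable1_diffP; case: (dF _ n0).
  - move=> t; rewrite in_itv/= andbT => nt; rewrite derive1E.
    by case: (dF t (lt_trans n0 nt)).
have : (\int[mu]_(t in E n) (f t)%:E @[n --> \oo] --> (B - A)%:E)%E.
  rewrite (_ : (fun n => _) = (fun n => (B - F n.+1%:R^-1)%:E)); last exact/funext.
  apply: cvg_EFin; first exact: nearW.
  apply: cvgB; first exact: cvg_cst.
  move/cvg_at_rightP : FA; apply; split; first by move=> n; rewrite invr_gt0.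
  exact: cvg_harmonic.
have := @ge0_nondecreasing_set_cvg_integral _ (measurableTypeR R) R E (EFin \o f) mu.
move=> /(_ _ _ _ _) /[!EU] h1 h2.
apply: (cvg_unique _ (h1 _ _ _ _) h2); first exact: ereal_hausdorff.
- move=> m n mn; apply/subsetPset => t; rewrite /E/= !in_itv/= !andbT.
  by apply: le_trans; rewrite lef_pV2 ?posrE// ler_nat.
- by move=> n; exact: measurable_itv.
- move=> n; apply/measurable_EFinP.
  apply: (measurable_funS measurable_pos_itv); last exact: continuous_measurable_pos.
  by rewrite EU; exact: bigcup_sup.
- by move=> n t /Epos /f0; rewrite /= lee_fin.
Qed.

Lemma ge0_FTC_pos_integrable f F A B :
  (forall t : R, 0 < t -> 0 <= f t) ->
  (forall t : R, 0 < t -> {for t, continuous f}) ->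
  (forall t : R, 0 < t -> is_derive t 1 F (f t)) ->
  (F t @[t --> 0^'+] --> A) -> (F t @[t --> +oo] --> B) ->
  mu.-integrable pos_itv (EFin \o f).
Proof.
move=> f0 cf dF FA FB; apply/integrableP; split.
  by apply/measurable_EFinP; exact: continuous_measurable_pos.
rewrite (_ : (\int[mu]_(t in pos_itv) _)%E = (\int[mu]_(t in pos_itv) (f t)%:E)%E).
  by rewrite (@ge0_FTC_pos f F A B) ?ltry.
apply: eq_integral => t; rewrite inE/= in_itv/= andbT => t0.
by rewrite ger0_norm// f0.
Qed.

Lemma le_integrable_pos f h :
  (forall t : R, 0 < t -> {for t, continuous f}) ->
  (forall t : R, 0 < t -> `|f t| <= h t) ->
  mu.-integrable pos_itv (EFin \o h) -> mu.-integrable pos_itv (EFin \o f).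
Proof.
move=> cf fh; apply: le_integrable; first exact: measurable_pos_itv.
  by apply/measurable_EFinP; exact: continuous_measurable_pos.
move=> t/=; rewrite in_itv/= andbT => t0; rewrite lee_fin.
exact/(le_trans (fh t t0))/ler_norm.
Qed.

(* Signed version: apply the nonnegative one to [f + h]. *)
Lemma FTC_pos f F h H A B A' B' :
  (forall t : R, 0 < t -> `|f t| <= h t) ->
  (forall t : R, 0 < t -> {for t, continuous f}) ->
  (forall t : R, 0 < t -> {for t, continuous h}) ->
  (forall t : R, 0 < t -> is_derive t 1 F (f t)) ->
  (forall t : R, 0 < t -> is_derive t 1 H (h t)) ->
  (F t @[t --> 0^'+] --> A) -> (F t @[t --> +oo] --> B) ->
  (H t @[t --> 0^'+] --> A') -> (H t @[t --> +oo] --> B') ->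
  \int[mu]_(t in pos_itv) f t = B - A.
Proof.
move=> fh cf ch dF dH FA FB HA HB.
have h0 t : 0 < t -> 0 <= h t by move=> /fh; exact: le_trans.
have ih : mu.-integrable pos_itv (EFin \o h).
  exact: (@ge0_FTC_pos_integrable h H A' B').
have if_ : mu.-integrable pos_itv (EFin \o f) by exact: (@le_integrable_pos f h).
have Ih : \int[mu]_(t in pos_itv) h t = B' - A'.
  by rewrite /Rintegral (@ge0_FTC_pos h H A' B').
have : \int[mu]_(t in pos_itv) (f t + h t) = (B + B') - (A + A').
  have dFH (t : R) : 0 < t -> is_derive t 1 (fun t => F t + H t) (f t + h t).
    by move=> t0; apply: is_deriveD; [exact: dF|exact: dH].
  rewrite /Rintegral (@ge0_FTC_pos (fun t => f t + h t) _ (A + A') (B + B') _ _ dFH)//.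
  - move=> t t0; rewrite -lerBlDr sub0r.
    by have := fh t t0; rewrite ler_norml => /andP[].
  - by move=> t t0; apply: cvgD; [exact: cf|exact: ch].
  - exact: cvgD.
  - exact: cvgD.
rewrite RintegralD ?Ih//.
set I := (X in X + _ = _ -> X = _); move: I => I /eqP; rewrite -subr_eq0 => /eqP E.
by apply/eqP; rewrite -subr_eq0 -E; apply/eqP; ring.
Qed.

Lemma is_derive_ext (f g : R -> R) (t df dg : R) :
  is_derive t 1 f df -> f =1 g -> df = dg -> is_derive t 1 g dg.
Proof. by move=> h /funext <- <-. Qed.

Lemma is_derive_continuous (f : R -> R) (t df : R) :
  is_derive t 1 f df -> {for t, continuous f}.
Proof.
by case=> d _; apply: differentiable_continuous; apply/derivable1_diffP.
Qed.

End FTC_pos.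

(** * Real and imaginary parts of Euler's integral *)

Section Gamma_parts.
Local Open Scope classical_set_scope.
Variable R : realType.
Local Notation mu := (@lebesgue_measure R).
Local Notation pos_itv := `](0 : R), +oo[%classic.
Implicit Types s u a b t : R.

(** Apply ln y < y at y = t / (2 s) and multiply by s; the constant is (2 s)^s. *)
Lemma powR_le_expR s : 0 < s ->
  exists2 C : R, 0 <= C & forall t : R, 0 < t -> t `^ s <= C * expR (t / 2).
Proof.
move=> s0; exists (expR (s * ln (2 * s))); first exact: expR_ge0.
move=> t t0; rewrite /powR gt_eqF// -expRD ler_expR.
have s2 : 0 < 2 * s by rewrite mulr_gt0.
have -> : ln t = ln (t / (2 * s)) + ln (2 * s).
  by rewrite -lnM ?posrE ?divr_gt0// divfK ?gt_eqF.
rewrite mulrDr addrC lerD2l.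
have /ltW := ln_sublinear (divr_gt0 t0 s2).
rewrite -(ler_pM2l s0) => /le_trans; apply.
by rewrite le_eqVlt; apply/orP; left; apply/eqP; field; rewrite gt_eqF.
Qed.

(** This is the real part of (a - ib) t^(s+iu) e^(-t). The pairs (1, 0) and (0, 1) give the real and
    imaginary parts of t^(s+iu) e^(-t); general coefficients make the family stable under
    differentiation. *)
Definition gpart s u a b t : R :=
  t `^ s * expR (- t) * (a * cos (u * ln t) + b * sin (u * ln t)).

(** Differentiating t^(s+iu) multiplies a - ib by s + iu, which produces the new coefficients; the
    subtracted term comes from e^(-t). *)
Lemma is_derive_gpart s u a b t : 0 < t ->
  is_derive t 1 (gpart s u a b)
    (gpart (s - 1) u (s * a + u * b) (s * b - u * a) t - gpart s u a b t).
Proof.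
move=> t0.
have dl := is_derive1_ln t0.
have dp := is_derive1_powR s t0.
have de : is_derive t 1 (expR \o -%R) (- expR (- t)).
  by apply: is_derive_eq; rewrite mulrN1.
have dul : is_derive t 1 (fun t => u * ln t) (u / t).
  exact: (is_derive_ext (is_deriveZ u dl)).
have dc : is_derive t 1 (cos \o (fun t => u * ln t)) (- sin (u * ln t) * (u / t)).
  exact: is_derive1_comp.
have ds : is_derive t 1 (sin \o (fun t => u * ln t)) (cos (u * ln t) * (u / t)).
  exact: is_derive1_comp.
have dT := is_deriveD (is_deriveZ a dc) (is_deriveZ b ds).
apply: (is_derive_ext (is_deriveM (is_deriveM dp de) dT)) => //.
rewrite /gpart (_ : t `^ (s - 1) = t `^ s / t); last first.
  rewrite powRB; last by rewrite (@gt_eqF _ _ t) ?implybT.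
  by rewrite powRr1 ?ltW.
change (t `^ s * expR (- t) *
    (a * (- sin (u * ln t) * (u / t)) + b * (cos (u * ln t) * (u / t))) +
  (a * cos (u * ln t) + b * sin (u * ln t)) *
    (t `^ s * - expR (- t) + expR (- t) * (s * (t `^ s / t))) =
  t `^ s / t * expR (- t) *
    ((s * a + u * b) * cos (u * ln t) + (s * b - u * a) * sin (u * ln t)) -
  t `^ s * expR (- t) * (a * cos (u * ln t) + b * sin (u * ln t))).
by field; rewrite gt_eqF.
Qed.

Lemma continuous_gpart s u a b t : 0 < t -> {for t, continuous (gpart s u a b)}.
Proof. by move=> t0; exact: (is_derive_continuous (is_derive_gpart s u a b t0)). Qed.

Lemma normr_gpart s u a b t :
  `|gpart s u a b t| <= (`|a| + `|b|) * (t `^ s * expR (- t)).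
Proof.
rewrite /gpart normrM mulrC ler_pM//.
  rewrite (le_trans (ler_normD _ _))// lerD// normrM ler_piMr//.
    by rewrite ler_norml cos_geN1 cos_le1.
  by rewrite ler_norml sin_geN1 sin_le1.
by rewrite ger0_norm// mulr_ge0 ?powR_ge0 ?expR_ge0.
Qed.

(* The derivative of [- 1 / (1 + t^s)]: it dominates [t^(s-1) e^(-t)] up to a
   constant, and its integral over ]0, +oo[ is 1. *)
Definition dominant s t : R := s * t `^ (s - 1) / (1 + t `^ s) ^+ 2.

Definition dominant_prim s t : R := - (1 + t `^ s)^-1.

Lemma onep_powR_gt0 s t : 0 < 1 + t `^ s.
Proof. by rewrite ltr_pwDl// powR_ge0. Qed.

Lemma is_derive_dominant s t : 0 < t ->
  is_derive t 1 (dominant_prim s) (dominant s t).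
Proof.
move=> t0; have dp := is_derive1_powR s t0.
have d1 : is_derive t 1 (fun t => 1 + t `^ s) (0 + s * t `^ (s - 1)).
  exact: is_deriveD.
have n0 : 1 + t `^ s != 0 by rewrite gt_eqF// onep_powR_gt0.
have dV := is_deriveV (f := fun t : R => 1 + t `^ s) n0 d1.
apply: (is_derive_ext (is_deriveN dV)) => //; rewrite /dominant /GRing.scale/=.
by field.
Qed.

Lemma continuous_dominant s t : 0 < t -> {for t, continuous (dominant s)}.
Proof.
move=> t0.
have cp r : {for t, continuous (fun t : R => t `^ r)}.
  exact: (is_derive_continuous (is_derive1_powR r t0)).
apply: cvgM; first by apply: cvgM; [exact: cvg_cst|exact: cp].
apply: cvgV; first by rewrite expf_neq0// gt_eqF// onep_powR_gt0.
apply: (@cvg_comp _ _ _ (fun t => 1 + t `^ s) (fun x => x ^+ 2)); last exact: exprn_continuous.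
by apply: cvgD; [exact: cvg_cst|exact: cp].
Qed.

Lemma cvg_powR_pinfty s : 0 < s -> t `^ s @[t --> +oo] --> +oo.
Proof.
move=> s0; apply/cvgryPge => A; near=> t.
have t1 : 1 <= t by near: t; exact: nbhs_pinfty_ge.
(* Beyond this threshold t^s >= e^A >= 1 + A. *)
have tA : expR (A / s) <= t by near: t; apply: nbhs_pinfty_ge; exact: num_real.
have t0 : 0 < t by exact: lt_le_trans t1.
apply: (@le_trans _ _ (expR A)); first by rewrite ltW// (lt_le_trans _ (expR_ge1Dx _))// ltrDr.
rewrite /powR gt_eqF// ler_expR mulrC -ler_pdivrMr//.
by rewrite -ler_expR lnK.
Unshelve. all: by end_near. Qed.

Lemma dominant_prim_cvg0 s : 0 < s -> dominant_prim s t @[t --> 0^'+] --> (-1 : R).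
Proof.
move=> s0; apply: cvgN; have e : (1 : R) = (1 + 0)^-1 by rewrite addr0 invr1.
rewrite [X in _ --> X]e.
apply: cvgV; first by rewrite addr0 oner_neq0.
by apply: cvgD; [exact: cvg_cst|exact: powR_cvg0].
Qed.

Lemma dominant_prim_cvgy s : 0 < s -> dominant_prim s t @[t --> +oo] --> (0 : R).
Proof.
move=> s0; rewrite -oppr0; apply: cvgN; apply/gtr0_cvgV0.
  by near=> t; exact: onep_powR_gt0.
apply/cvgryPge => A; near=> t.
rewrite (@le_trans _ _ (t `^ s))//; last by rewrite lerDr.
near: t; move: A; apply/cvgryPge; exact: cvg_powR_pinfty.
Unshelve. all: by end_near. Qed.

Lemma gpart_dominated s u a b : -1 < s ->
  exists K : R, forall t : R, 0 < t -> `|gpart s u a b t| <= K * dominant (s + 1) t.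
Proof.
move=> s1; have s0 : 0 < s + 1 by lra.
have [C C0 hC] := powR_le_expR s0.
(* The square comes from squaring 1 + t^(s+1) <= (1 + C) e^(t/2); the division by s + 1 cancels the
   factor s + 1 of [dominant]. *)
exists ((`|a| + `|b|) * (1 + C) ^+ 2 / (s + 1)) => t t0.
apply: (le_trans (normr_gpart _ _ _ _ _)).
rewrite -!(mulrA (`|a| + `|b|)) ler_wpM2l ?addr_ge0// /dominant addrK.
have -> : (1 + C) ^+ 2 / (s + 1) * ((s + 1) * t `^ s / (1 + t `^ (s + 1)) ^+ 2)
  = t `^ s * ((1 + C) ^+ 2 / (1 + t `^ (s + 1)) ^+ 2).
  by field; rewrite !gt_eqF ?onep_powR_gt0.
rewrite ler_wpM2l ?powR_ge0// ler_pdivlMr ?exprn_gt0 ?onep_powR_gt0//.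
rewrite expRN mulrC ler_pdivrMr ?expR_gt0//.
have -> : expR t = expR (t / 2) ^+ 2 by rewrite -expRM_natl; congr expR; field.
rewrite -exprMn lerXn2r ?nnegrE ?(ltW (onep_powR_gt0 _ _))//.
  by rewrite mulr_ge0 ?expR_ge0// addr_ge0.
rewrite mulrDl mul1r lerD ?hC//.
by rewrite -expR0 ler_expR divr_ge0 ?ltW.
Qed.

Lemma gpart_integrable s u a b : -1 < s -> mu.-integrable pos_itv (EFin \o gpart s u a b).
Proof.
move=> s1; have [K hK] := gpart_dominated u a b s1.
apply: (@le_integrable_pos _ _ (fun t => K * dominant (s + 1) t) _ hK).
  by move=> t; exact: continuous_gpart.
have s0 : 0 < s + 1 by lra.
rewrite (_ : EFin \o _ = (fun t => K%:E * (EFin \o dominant (s + 1)) t)%E)//.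
apply: integrableZl; first exact: measurable_pos_itv.
apply: (@ge0_FTC_pos_integrable _ _ (dominant_prim (s + 1)) (-1) 0).
- move=> t t0; rewrite /dominant divr_ge0 ?exprn_ge0 ?(ltW (onep_powR_gt0 _ _))//.
  by rewrite mulr_ge0 ?powR_ge0// ltW.
- by move=> t; exact: continuous_dominant.
- by move=> t; exact: is_derive_dominant.
- exact: dominant_prim_cvg0.
- exact: dominant_prim_cvgy.
Qed.

Lemma gpart_cvg0 s u a b : 0 < s -> gpart s u a b t @[t --> 0^'+] --> (0 : R).
Proof.
move=> s0; apply/norm_cvg0P.
apply: (@squeeze_cvgr _ _ _ _ (fun=> 0) (fun t => (`|a| + `|b|) * t `^ s)).
- near=> t; rewrite normr_ge0/= (le_trans (normr_gpart _ _ _ _ _))//.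
  rewrite ler_wpM2l ?addr_ge0// ler_piMr ?powR_ge0//.
  by rewrite -expR0 ler_expR oppr_le0 ltW.
- exact: cvg_cst.
- rewrite -[X in _ --> X](mulr0 (`|a| + `|b|)).
  by apply: cvgM; [exact: cvg_cst|exact: powR_cvg0].
Unshelve. all: by end_near. Qed.

(** Half of the exponential decay absorbs t^s, and e^(-t/2) remains. *)
Lemma gpart_cvgy s u a b : 0 < s -> gpart s u a b t @[t --> +oo] --> (0 : R).
Proof.
move=> s0; apply/norm_cvg0P; have [C C0 hC] := powR_le_expR s0.
apply: (@squeeze_cvgr _ _ _ _ (fun=> 0)
  (fun t => (`|a| + `|b|) * C * expR (- (t / 2)))).
- near=> t; rewrite normr_ge0/= (le_trans (normr_gpart _ _ _ _ _))//.
  rewrite -mulrA ler_wpM2l ?addr_ge0//.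
  have -> : - (t / 2) = t / 2 + - t by field.
  by rewrite expRD mulrA ler_wpM2r ?expR_ge0// hC.
- exact: cvg_cst.
- rewrite -[X in _ --> X](mulr0 ((`|a| + `|b|) * C)).
  apply: cvgM; first exact: cvg_cst.
  apply: (@cvg_comp _ _ _ (fun t => t / 2) (fun t => expR (- t)) _ +oo); last exact: cvgr_expR.
  by apply: gt0_cvgMly => //; exact: cvg_id.
Unshelve. all: by end_near. Qed.

Definition Gpart s u a b : R := \int[mu]_(t in pos_itv) gpart s u a b t.

(** Integration by parts: [gpart s u a b] tends to 0 at both ends, so its derivative has integral
    0. *)
Lemma Gpart_rec s u a b : 0 < s ->
  Gpart s u a b = Gpart (s - 1) u (s * a + u * b) (s * b - u * a).
Proof.
move=> s0; have s1 : -1 < s - 1 by lra.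
have s1' : -1 < s by lra.
have [K1 hK1] := gpart_dominated u (s * a + u * b) (s * b - u * a) s1.
have [K2 hK2] := gpart_dominated u a b s1'.
have dG (t : R) : 0 < t -> is_derive t 1 (gpart s u a b)
    (gpart (s - 1) u (s * a + u * b) (s * b - u * a) t - gpart s u a b t).
  by move=> t0; exact: is_derive_gpart.
(* The dominating function required by [FTC_pos] is the sum of the bounds for the two terms of the
   derivative; [H] is its primitive. *)
pose h t := K1 * dominant (s - 1 + 1) t + K2 * dominant (s + 1) t.
pose H t := K1 * dominant_prim (s - 1 + 1) t + K2 * dominant_prim (s + 1) t.
have dH (t : R) : 0 < t -> is_derive t 1 H (h t).
  move=> t0; have d1 := is_deriveZ K1 (is_derive_dominant (s - 1 + 1) t0).
  have d2 := is_deriveZ K2 (is_derive_dominant (s + 1) t0).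
  exact: (is_deriveD d1 d2).
have -> : Gpart (s - 1) u (s * a + u * b) (s * b - u * a) =
  \int[mu]_(t in pos_itv) (gpart (s - 1) u (s * a + u * b) (s * b - u * a) t -
    gpart s u a b t) + Gpart s u a b.
  rewrite RintegralB; [|exact: measurable_pos_itv|exact: gpart_integrable|exact: gpart_integrable].
  by rewrite subrK.
have s0' : 0 < s - 1 + 1 by lra.
have s0'' : 0 < s + 1 by lra.
rewrite (@FTC_pos _ _ (gpart s u a b) h H 0 0
  (K1 * -1 + K2 * -1) (K1 * 0 + K2 * 0) _ _ _ dG dH) ?subrr ?add0r//.
- move=> t t0; apply: (le_trans (ler_normB _ _)); rewrite lerD ?hK2//.
  exact: hK1.
- by move=> t t0; apply: cvgB; exact: continuous_gpart.
- by move=> t t0; apply: cvgD; (apply: cvgM; [exact: cvg_cst|exact: continuous_dominant]).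
- exact: gpart_cvg0.
- exact: gpart_cvgy.
- by apply: cvgD; (apply: cvgM; [exact: cvg_cst|exact: dominant_prim_cvg0]).
- by apply: cvgD; (apply: cvgM; [exact: cvg_cst|exact: dominant_prim_cvgy]).
Qed.

Lemma Gpart00 : Gpart 0 0 1 0 = 1.
Proof.
have dE (t : R) : 0 < t -> is_derive t 1 (fun t => - expR (- t)) (gpart 0 0 1 0 t).
  move=> t0; have de : is_derive t 1 (expR \o -%R) (- expR (- t)).
    by apply: is_derive_eq; rewrite mulrN1.
  apply: (is_derive_ext (is_deriveN de)) => //.
  by rewrite /gpart powRr0 mul0r cos0 sin0 opprK; ring.
rewrite /Gpart /Rintegral (@ge0_FTC_pos _ _ _ (-1) 0 _ _ dE) /= ?opprK ?add0r//.
- by move=> t t0; rewrite /gpart powRr0 !mul0r cos0 !mul1r addr0 mulr1 expR_ge0.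
- by move=> t; exact: continuous_gpart.
- have e : (-1 : R) = - expR (- 0) by rewrite oppr0 expR0.
  rewrite [X in _ --> X]e; apply: cvgN; apply: continuous_cvg; first exact: continuous_expR.
  by apply: cvgN; apply: cvg_at_right_filter; exact: cvg_id.
- by rewrite -oppr0; apply: cvgN; exact: cvgr_expR.
Qed.

Lemma GpartZD s u a b x y a' b' : -1 < s ->
  Gpart s u (x * a + y * a') (x * b + y * b') = x * Gpart s u a b + y * Gpart s u a' b'.
Proof.
move=> s1; have mI : measurable pos_itv by exact: measurable_pos_itv.
have iZ z c d : mu.-integrable pos_itv (EFin \o (fun t => z * gpart s u c d t)).
  rewrite (_ : EFin \o _ = (fun t => z%:E * (EFin \o gpart s u c d) t)%E)//.
  by apply: integrableZl => //; exact: gpart_integrable.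
rewrite /Gpart -!RintegralZl//; try exact: gpart_integrable.
rewrite -RintegralD//; apply: eq_Rintegral => t _.
by rewrite /gpart; ring.
Qed.

End Gamma_parts.

(** * The Gamma function *)

Section Gamma_function.
Local Open Scope classical_set_scope.
Variable R : realType.
Local Notation mu := (@lebesgue_measure R).
Local Notation pos_itv := `](0 : R), +oo[%classic.
Implicit Types (x : R[i]) (n : nat).

Lemma realM_complex (a c d : R) : a%:C * (c +i* d) = (a * c) +i* (a * d).
Proof. by apply/eqP; rewrite eq_complex /= !mul0r subr0 addr0 !eqxx. Qed.

Lemma mul_complexE (a b c d : R) :
  (a +i* b) * (c +i* d) = (a * c - b * d) +i* (a * d + b * c).
Proof. by []. Qed.

Lemma Gamma_integrandE x (t : R) : 0 < t ->
  Gamma_integrand x t = gpart (complex.Re x - 1) (complex.Im x) 1 0 t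
    +i* gpart (complex.Re x - 1) (complex.Im x) 0 1 t.
Proof.
case: x => s u t0; rewrite /Gamma_integrand /cexp /gpart /powR gt_eqF//=.
rewrite !mulr0 !subr0 !add0r realM_complex mulrC realM_complex.
by congr (_ +i* _); ring.
Qed.

Lemma GammaE x : Gamma x = Gpart (complex.Re x - 1) (complex.Im x) 1 0
  +i* Gpart (complex.Re x - 1) (complex.Im x) 0 1.
Proof.
rewrite /Gamma /Gpart; congr (_ +i* _); apply: eq_Rintegral => t ht;
  (have t0 : 0 < t by [move: ht; rewrite inE/= in_itv/= andbT]);
  by rewrite Gamma_integrandE.
Qed.

(** [Gpart_rec] sends the pairs (1, 0) and (0, 1) to (s, -u) and (u, s); by linearity these are the
    real and imaginary parts of a multiplication by s + iu. *)
Lemma GammaS x : 0 < complex.Re x -> Gamma (x + 1) = x * Gamma x.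
Proof.
case: x => s u /= s0; rewrite !GammaE /= addr0 addrK.
have s1 : -1 < s - 1 by lra.
have e1 : Gpart s u 1 0 = s * Gpart (s - 1) u 1 0 - u * Gpart (s - 1) u 0 1.
  rewrite Gpart_rec// -(mulNr u (Gpart _ _ _ _)) -GpartZD//; congr Gpart; ring.
have e2 : Gpart s u 0 1 = s * Gpart (s - 1) u 0 1 + u * Gpart (s - 1) u 1 0.
  rewrite Gpart_rec// -GpartZD//; congr Gpart; ring.
by rewrite e1 e2.
Qed.

Lemma Gpart_im0 (s : R) : Gpart s 0 0 1 = 0.
Proof.
transitivity (\int[mu]_(t in pos_itv) (0 : R)).
  by apply: eq_Rintegral => t _; rewrite /gpart !mul0r sin0 mulr0 addr0 mulr0.
by rewrite /Rintegral integral0.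
Qed.

Lemma Gpart_natr n : Gpart n%:R 0 1 0 = n`!%:R :> R.
Proof.
elim: n => [|n IH]; first exact: Gpart00.
rewrite Gpart_rec ?ltr0n// -natr1 addrK !mul0r mulr0 addr0 mulr1 subr0.
have n1 : -1 < n%:R :> R by rewrite (lt_le_trans (ltrN10 _)).
have := GpartZD 0 1 0 (n%:R + 1) 0 0 0 n1.
rewrite mulr1 !mulr0 !mul0r !addr0 => ->.
by rewrite IH factS natrM natr1.
Qed.

Lemma Gamma_natS n : Gamma (n.+1%:R : R[i]) = (n`!%:R : R)%:C.
Proof.
rewrite GammaE.
have -> : complex.Re (n.+1%:R : R[i]) = n.+1%:R
  by rewrite -[n.+1%:R in LHS](rmorph_nat (real_complex R)).
have -> : complex.Im (n.+1%:R : R[i]) = 0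
  by rewrite -[n.+1%:R in LHS](rmorph_nat (real_complex R)).
by rewrite -natr1 addrK Gpart_natr Gpart_im0.
Qed.

(** * The value of Gamma at 1/2, from the Gaussian integral *)

Lemma cvg_integral0_gauss :
  gauss_integral_proof.integral0_gauss y @[y --> +oo] --> (Num.sqrt pi / 2 : R).
Proof.
have : Num.sqrt (@gauss_integral_proof.integral0_gauss R x ^+ 2) @[x --> +oo]
    --> Num.sqrt (pi / 4).
  by apply: continuous_cvg; [exact: sqrt_continuous|
    exact: gauss_integral_proof.cvg_integral0_gauss_sqr].
rewrite sqrtrM ?pi_ge0// sqrtrV// (_ : 4 = 2 ^+ 2); last by rewrite expr2 -natrM.
rewrite sqrtr_sqr ger0_norm//.
under eq_fun do rewrite sqrtr_sqr ger0_norm ?gauss_integral_proof.integral0_gauss_ge0//.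
by [].
Qed.

(* [2 * integral0_gauss (sqrt t)] is a primitive of [t^(-1/2) e^(-t)]. *)
Lemma Gpart_half : Gpart (- 2^-1) 0 1 0 = Num.sqrt pi :> R.
Proof.
pose E := @gauss_integral_proof.integral0_gauss R.
have iE (y : R) : mu.-integrable `[0, y] (EFin \o gauss_fun).
  by apply: integrableS (integrableT_gauss) => //; exact: measurable_itv.
have dE (y : R) : 0 < y -> is_derive y 1 E (gauss_fun y).
  move=> y0; have y1 : y < y + 1 by rewrite ltrDl.
  have [] := @continuous_FTC1_closed R gauss_fun 0 y (y + 1) y1 (iE _) y0
    (@continuous_gauss_fun _ y).
  by move=> d1 d2; apply: DeriveDef; [exact: d1|rewrite -derive1E; exact: d2].
have dF (t : R) : 0 < t ->
    is_derive t 1 (fun t => 2 * E (t `^ 2^-1)) (gpart (- 2^-1) 0 1 0 t).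
  move=> t0; have dp := is_derive1_powR 2^-1 t0.
  have p0 : 0 < t `^ 2^-1 by rewrite powR_gt0.
  have := is_deriveZ 2 (is_derive1_comp (g := fun t : R => t `^ 2^-1) (dE _ p0) dp).
  move=> d; apply: (is_derive_ext d) => //.
  rewrite /gpart /gauss_fun -powR_mulrn ?powR_ge0// -powRrM mulVf ?pnatr_eq0//.
  rewrite powRr1 ?ltW// !mul0r cos0 addr0 !mulr1 /GRing.scale/=.
  have -> : 2^-1 - 1 = - 2^-1 :> R by field.
  by field.
rewrite /Gpart /Rintegral (@ge0_FTC_pos _ _ _ 0 (Num.sqrt pi) _ _ dF) ?subr0//.
- move=> t t0; rewrite /gpart mul0r cos0 mulr1 mul0r addr0 mulr1.
  by rewrite mulr_ge0 ?powR_ge0 ?expR_ge0.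
- by move=> t; exact: continuous_gpart.
- rewrite -[X in _ --> X](mulr0 2); apply: cvgM; first exact: cvg_cst.
  apply: (@cvg_comp _ _ _ (fun t : R => t `^ 2^-1) E _ (nbhs 0)).
    by apply: powR_cvg0; rewrite invr_gt0.
  exact: (parameterized_integral_cvg_left (f := gauss_fun) ltr01 (iE 1)).
- have -> : Num.sqrt pi = 2 * (Num.sqrt pi / 2) :> R by field.
  apply: cvgM; first exact: cvg_cst.
  apply: (@cvg_comp _ _ _ (fun t : R => t `^ 2^-1) E _ +oo); last exact: cvg_integral0_gauss.
  by apply: cvg_powR_pinfty; rewrite invr_gt0.
Qed.

Lemma Gamma_half : Gamma (2^-1 : R[i]) = (Num.sqrt pi : R)%:C.
Proof.
have -> : (2^-1 : R[i]) = (2^-1 : R)%:C by rewrite fmorphV rmorph_nat.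
rewrite GammaE /= Gpart_im0.
have -> : 2^-1 - 1 = - 2^-1 :> R by field.
by rewrite Gpart_half.
Qed.

End Gamma_function.

(** * Asymptotics of Gamma(N + z) *)

Section Gamma_asymptotics.
Local Open Scope classical_set_scope.
Variable R : realType.
Local Notation mu := (@lebesgue_measure R).
Local Notation pos_itv := `](0 : R), +oo[%classic.
Implicit Types (s u : R) (n m k : nat) (p : {poly R}).

(** * Bounds on y^z - 1 for real y > 0 *)

Lemma derive_le1_lip (f df : R -> R) : (forall y : R, is_derive y 1 f (df y)) ->
  (forall y, `|df y| <= 1) -> forall y, `|f y - f 0| <= `|y|.
Proof.
move=> dF df1 y.
have cf a b : {within `[a, b], continuous f}.
  by apply: continuous_subspaceT => z; exact: (is_derive_continuous (dF z)).
have [y0|/ltW y0] := leP 0 y.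
  have [c _ ->] := MVT_segment y0 (fun z _ => dF z) (cf _ _).
  by rewrite subr0 normrM ler_piMl.
have [c _] := MVT_segment y0 (fun z _ => dF z) (cf _ _).
by rewrite distrC sub0r => ->; rewrite normrM normrN ler_piMl.
Qed.

Lemma normr_sin_le (y : R) : `|sin y| <= `|y|.
Proof.
have := @derive_le1_lip sin cos (fun z => is_derive_sin z).
rewrite sin0 => /(_ _ y); rewrite subr0; apply => z.
by rewrite ler_norml cos_geN1 cos_le1.
Qed.

Lemma normr_cos_sub1_le (y : R) : `|cos y - 1| <= `|y|.
Proof.
have := @derive_le1_lip cos (fun z => - sin z) (fun z => is_derive_cos z).
by rewrite cos0; apply => z; rewrite normrN ler_norml sin_geN1 sin_le1.
Qed.

(** Passing from a real exponent to a natural one makes the bounds polynomial, so that their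
    integrals against the gamma density reduce to moments. *)
Lemma powR_le_onepX s m (y : R) : 0 <= s <= m%:R -> 0 < y -> y `^ s <= 1 + y ^+ m.
Proof.
move=> /andP[s0 sm] y0; have [y1|/ltW y1] := leP y 1.
  rewrite (@le_trans _ _ 1)//; last by rewrite lerDl exprn_ge0// ltW.
  by rewrite /powR gt_eqF// -[leRHS]expR0 ler_expR mulr_ge0_le0 ?ln_le0.
rewrite (@le_trans _ _ (y ^+ m))//; last by rewrite lerDr.
by rewrite -powR_mulrn ?(ltW y0)// ler_powR.
Qed.

(** For y >= 1, ln y <= y - 1. For y < 1, -ln y <= (1 - y) / y, and y^s <= y absorbs the pole at 0;
    this is where s >= 1 enters. *)
Lemma powR_mul_ln_le s m (y : R) : 1 <= s <= m%:R -> 0 < y ->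
  y `^ s * `|ln y| <= `|y - 1| * (1 + y ^+ m).
Proof.
move=> /andP[s1 sm] y0; have ym : 0 <= y ^+ m by rewrite exprn_ge0// ltW.
have [y1|y1] := leP 1 y.
  rewrite ger0_norm ?ln_ge0// ger0_norm ?subr_ge0// mulrC ler_pM ?ln_ge0 ?powR_ge0//.
    by have := @le_ln1Dx R (y - 1); rewrite addrCA subrr addr0; apply; lra.
  by apply: powR_le_onepX => //; rewrite sm andbT; lra.
rewrite ler0_norm ?ln_le0 ?(ltW y1)// ler0_norm ?subr_le0 ?(ltW y1)//.
have lnV : - ln y <= (1 - y) / y.
  rewrite -lnV ?posrE//; have := @le_ln1Dx R (y^-1 - 1).
  rewrite addrCA subrr addr0 => h.
  have -> : (1 - y) / y = y^-1 - 1 by field; rewrite gt_eqF.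
  by apply: h; rewrite ltrBrDl subrr invr_gt0.
rewrite (@le_trans _ _ (1 - y))//; last by rewrite opprB ler_peMr ?lerDl ?subr_ge0 ?(ltW y1).
rewrite (@le_trans _ _ (y * ((1 - y) / y)))//; last by rewrite mulrC divfK ?gt_eqF.
rewrite ler_pM ?powR_ge0// ?oppr_ge0 ?ln_le0 ?(ltW y1)//.
rewrite /powR gt_eqF// -[leRHS]lnK ?posrE// ler_expR.
have /ltW l0 : ln y < 0 by apply: ln_lt0; rewrite y0.
by rewrite ler_neMl.
Qed.

(** For y >= 1, the inequality e^(-v) >= 1 - v at v = s ln y gives y^s - 1 <= s y^s ln y, and the
    previous bound applies. For y <= 1, 1 - y^s <= 1 - y^m <= m (1 - y), the last step being
    Bernoulli's inequality. *)
Lemma powR_sub1_le s m (y : R) : 1 <= s <= m%:R -> 0 < y ->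
  `|y `^ s - 1| <= m%:R * (`|y - 1| * (1 + y ^+ m)).
Proof.
move=> /andP[s1 sm] y0; have [y1|/ltW y1] := leP 1 y.
  have hl : 0 <= ln y by rewrite ln_ge0.
  rewrite ger0_norm; last first.
    by rewrite subr_ge0 -(powRr0 y) ler_powR//; lra.
  apply: (@le_trans _ _ (s * (y `^ s * `|ln y|))); last first.
    by rewrite ler_pM ?mulr_ge0 ?powR_ge0 ?powR_mul_ln_le ?s1//; lra.
  rewrite ger0_norm// /powR gt_eqF// mulrCA.
  have := expR_ge1Dx (- (s * ln y)); rewrite -(ler_pM2l (expR_gt0 (s * ln y))).
  rewrite -expRD subrr expR0; lra.
rewrite ler0_norm; last first.
  rewrite subr_le0 /powR gt_eqF// -[leRHS]expR0 ler_expR mulr_ge0_le0 ?ln_le0//; lra.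
rewrite ler0_norm ?subr_le0// !opprB.
have yX : 1 - y ^+ m <= m%:R * (1 - y).
  elim: (m) => [|k IH]; first by rewrite expr0 subrr mul0r.
  rewrite exprS -natr1 mulrDl mul1r.
  have -> : 1 - y * y ^+ k = y * (1 - y ^+ k) + (1 - y) by ring.
  rewrite lerD2r (le_trans _ IH)// ler_piMl// subr_ge0 exprn_ile1//; exact: ltW.
apply: (@le_trans _ _ (1 - y ^+ m)).
  rewrite lerD2l lerN2 -powR_mulrn ?(ltW y0)// /powR gt_eqF// ler_expR.
  by rewrite ler_wnM2r// ln_le0.
apply: (le_trans yX); rewrite ler_wpM2l// ler_peMr ?subr_ge0//.
by rewrite lerDl exprn_ge0// ltW.
Qed.

(** The two quantities are the real and imaginary parts of y^(s+iu) - 1. Replacing the oscillating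
    factor by its value at y = 1 costs at most |u ln y|, and [powR_mul_ln_le] controls y^s |ln
    y|. *)
Lemma cpow_sub1_le s u : 1 <= s -> exists (K : R) m, 0 <= K /\
  forall y : R, 0 < y ->
   `|y `^ s * cos (u * ln y) - 1| <= K * (`|y - 1| * (1 + y ^+ m)) /\
   `|y `^ s * sin (u * ln y)| <= K * (`|y - 1| * (1 + y ^+ m)).
Proof.
move=> s1; pose m := (Num.truncn s).+1.
have sm : 1 <= s <= m%:R by rewrite s1 ltW// truncnS_gt.
exists (m%:R + `|u|), m; split=> [|y y0]; first by rewrite addr_ge0.
have B0 : 0 <= `|y - 1| * (1 + y ^+ m) by rewrite mulr_ge0 ?addr_ge0 ?exprn_ge0 ?(ltW y0).
have hl : y `^ s * `|u * ln y| <= `|u| * (`|y - 1| * (1 + y ^+ m)).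
  by rewrite normrM mulrCA ler_wpM2l// powR_mul_ln_le.
split.
  have -> : y `^ s * cos (u * ln y) - 1 = (y `^ s - 1) + y `^ s * (cos (u * ln y) - 1) by ring.
  rewrite (le_trans (ler_normD _ _))// mulrDl lerD ?powR_sub1_le//.
  rewrite normrM ger0_norm ?powR_ge0// (le_trans _ hl)// ler_wpM2l ?powR_ge0//.
  exact: normr_cos_sub1_le.
rewrite normrM ger0_norm ?powR_ge0// (le_trans (y := `|u| * (`|y - 1| * (1 + y ^+ m))))//.
  by rewrite (le_trans _ hl)// ler_wpM2l ?powR_ge0// normr_sin_le.
by rewrite ler_wpM2r// lerDr.
Qed.

(* [moment n k] is the expectation of [(T / n.+1) ^ k] for [T] with density
   [t^n e^(-t) / n!]. *)
Definition moment n k : R := (n + k)`!%:R / (n`!%:R * n.+1%:R ^+ k).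

Lemma moment_cvg k : moment n k @[n --> \oo] --> (1 : R).
Proof.
elim: k => [|k IH].
  under eq_fun do rewrite /moment addn0 expr0 mulr1 divff ?pnatr_eq0 -?lt0n ?fact_gt0//.
  exact: cvg_cst.
have -> : (fun n => moment n k.+1) = (fun n => moment n k * (1 + k%:R * n.+1%:R^-1)).
  apply/funext => n; rewrite /moment addnS factS natrM exprS.
  have -> : (n + k).+1%:R = n.+1%:R + k%:R :> R by rewrite -natrD addSn.
  have F0 : n`!%:R != 0 :> R by rewrite pnatr_eq0 -lt0n fact_gt0.
  have N0 : n.+1%:R != 0 :> R by rewrite pnatr_eq0.
  by move: (n.+1%:R : R) N0 => N N0; field; rewrite ?F0 ?N0 ?expf_neq0.
rewrite -[X in _ --> X](mulr1 1); apply: cvgM => //.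
rewrite -[X in _ --> X](addr0 1); apply: cvgD; first exact: cvg_cst.
rewrite -[X in _ --> X](mulr0 k%:R); apply: cvgM; first exact: cvg_cst.
exact: cvg_harmonic.
Qed.

Lemma gpart_mulX n k (t : R) : 0 < t ->
  gpart n%:R 0 1 0 t * (t / n.+1%:R) ^+ k = gpart (n + k)%:R 0 1 0 t / n.+1%:R ^+ k.
Proof.
by move=> t0; rewrite /gpart !powR_mulrn ?(ltW t0)// exprD expr_div_n; ring.
Qed.

Lemma Rintegral_sum_lt (f : nat -> R -> R) k :
  (forall i, mu.-integrable pos_itv (EFin \o f i)) ->
  mu.-integrable pos_itv (EFin \o (fun t => \sum_(i < k) f i t)) /\
  \int[mu]_(t in pos_itv) (\sum_(i < k) f i t) = \sum_(i < k) \int[mu]_(t in pos_itv) f i t.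
Proof.
move=> fi; have mI : measurable pos_itv by exact: measurable_pos_itv.
elim: k => [|k [IH1 IH2]].
  under [X in EFin \o X]eq_fun do rewrite big_ord0.
  under eq_Rintegral do rewrite big_ord0.
  by split; [exact: integrable0|rewrite /Rintegral integral0 big_ord0].
under [X in EFin \o X]eq_fun do rewrite big_ord_recr/=.
under eq_Rintegral do rewrite big_ord_recr/=.
split.
  rewrite (_ : EFin \o _ = ((EFin \o (fun t => (\sum_(i < k) f i t)%R)) \+ (EFin \o f k))%E)//.
  exact: integrableD.
by rewrite RintegralD// IH2 big_ord_recr.
Qed.

(** Multiplying t^n e^(-t) by (t / (n+1))^k gives a rescaled t^(n+k) e^(-t), with integral (n+k)! /
    (n+1)^k. A polynomial in t / (n+1) is thus integrated by replacing its powers by moments. *)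
Lemma gpart_horner n p :
  mu.-integrable pos_itv (EFin \o (fun t => gpart n%:R 0 1 0 t * p.[t / n.+1%:R])) /\
  \int[mu]_(t in pos_itv) (gpart n%:R 0 1 0 t * p.[t / n.+1%:R]) =
    n`!%:R * \sum_(i < size p) p`_i * moment n i.
Proof.
have mI : measurable pos_itv by exact: measurable_pos_itv.
have nN1 k : -1 < k%:R :> R by rewrite (lt_le_trans (ltrN10 _)).
pose f i (t : R) := p`_i / n.+1%:R ^+ i * gpart (n + i)%:R 0 1 0 t.
have fi i : mu.-integrable pos_itv (EFin \o f i).
  rewrite (_ : EFin \o _ = (fun t => (p`_i / n.+1%:R ^+ i)%:E *
     (EFin \o gpart (n + i)%:R 0 1 0) t)%E)//.
  by apply: integrableZl => //; exact: gpart_integrable.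
have fE (t : R) : 0 < t ->
    \sum_(i < size p) f i t = gpart n%:R 0 1 0 t * p.[t / n.+1%:R].
  move=> t0; rewrite horner_coef mulr_sumr; apply: eq_bigr => i _.
  by rewrite mulrCA gpart_mulX// /f; ring.
have [h1 h2] := Rintegral_sum_lt (size p) fi.
split.
  apply: eq_integrable h1 => //= t; rewrite inE/= in_itv/= andbT => t0.
  by rewrite fE.
transitivity (\int[mu]_(t in pos_itv) (\sum_(i < size p) f i t)).
  by apply: eq_Rintegral => t; rewrite inE/= in_itv/= andbT => t0; rewrite fE.
rewrite h2 mulr_sumr; apply: eq_bigr => i _.
rewrite /f RintegralZl//; last exact: gpart_integrable.
rewrite -/(Gpart _ _ _ _) Gpart_natr /moment; field.
by rewrite pnatr_eq0 -lt0n fact_gt0 expf_neq0.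
Qed.

(* Chebyshev's argument: [|y - 1| <= e + (y - 1)^2 / e] bounds the integral by
   moments, whose limit is [2 e K]. *)
Lemma concentration (K : R) m (f : nat -> R -> R) : 0 <= K ->
  (forall n (t : R), 0 < t -> `|f n t| <= gpart n%:R 0 1 0 t *
     (K * (`|t / n.+1%:R - 1| * (1 + (t / n.+1%:R) ^+ m)))) ->
  (forall n, mu.-integrable pos_itv (EFin \o f n)) ->
  (n`!%:R)^-1 * \int[mu]_(t in pos_itv) f n t @[n --> \oo] --> (0 : R).
Proof.
move=> K0 fK fi; apply/cvgr0Pnorm_le => e e0.
(* The limiting bound 2 K d equals e K / (2 K + 1), which is less than [e]; the added 1 keeps the
   denominator positive when K = 0. *)
pose d := e / (2 * (2 * K + 1)).
have d0 : 0 < d by rewrite divr_gt0// mulr_gt0// ltr_wpDl// mulr_ge0.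
pose p : {poly R} := K *: ((d%:P + d^-1 *: ('X - 1%:P) ^+ 2) * (1 + 'X^m)).
have pE y : p.[y] = K * ((d + d^-1 * (y - 1) ^+ 2) * (1 + y ^+ m)).
  by rewrite /p !(hornerE, hornerXn, horner_exp).
have p1 : p.[1] = 2 * K * d by rewrite pE expr1n subrr expr0n /=; ring.
have le_p (y : R) : 0 < y -> K * (`|y - 1| * (1 + y ^+ m)) <= p.[y].
  move=> y0; rewrite pE ler_wpM2l// ler_wpM2r//.
    by rewrite addr_ge0 ?exprn_ge0 ?(ltW y0).
  rewrite -[(y - 1) ^+ 2]real_normK ?num_real//.
  move: (normr_ge0 (y - 1)) => /=; move: `|y - 1| => v v0.
  rewrite -(ler_pM2l d0) mulrDr mulVKf ?gt_eqF//.
  (* What remains is d v <= d^2 + v^2. *)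
  by have := sqr_ge0 (d - v); rewrite !expr2; nra.
have hI n : `|(n`!%:R)^-1 * \int[mu]_(t in pos_itv) f n t| <=
    \sum_(i < size p) p`_i * moment n i.
  have [ip Ip] := gpart_horner n p.
  rewrite normrM gtr0_norm ?invr_gt0 ?ltr0n ?fact_gt0//.
  rewrite ler_pdivrMl ?ltr0n ?fact_gt0// -Ip.
  apply: (le_trans (le_normr_Rintegral _ (fi n))); first exact: measurable_pos_itv.
  apply: le_Rintegral => //.
    exact: (integrable_norm (fi n)).
  move=> t/=; rewrite in_itv/= andbT => t0.
  rewrite (le_trans (fK n t t0))// ler_wpM2l ?le_p ?divr_gt0//.
  by rewrite /gpart mul0r cos0 mul0r mulr1 addr0 mulr1 mulr_ge0 ?powR_ge0 ?expR_ge0.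
have cI : \sum_(i < size p) p`_i * moment n i @[n --> \oo] --> p.[1].
  rewrite horner_coef; apply: cvg_big => [|i _]; first exact: add_continuous.
  by rewrite expr1n; apply: cvgM; [exact: cvg_cst|exact: moment_cvg].
near=> n; apply: (le_trans (hI n)).
near: n; apply: (cvgr_le _ cI); rewrite p1 /d.
have K1 : 0 < 2 * K + 1 by rewrite ltr_wpDl// mulr_ge0.
rewrite mulrA ltr_pdivrMr ?mulr_gt0//; nra.
Unshelve. all: by end_near. Qed.

(** With N = n + 1, t^(s+iu) = N^(s+iu) (t/N)^(s+iu). The coefficients on the left are those of (c -
    id) N^(-iu), chosen to cancel the phase N^(iu). *)
Lemma gpart_shift s u n (c d t : R) : 0 < t ->
  gpart (n%:R + s) u (c * cos (u * ln n.+1%:R) - d * sin (u * ln n.+1%:R))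
    (c * sin (u * ln n.+1%:R) + d * cos (u * ln n.+1%:R)) t =
  n.+1%:R `^ s * (gpart n%:R 0 1 0 t * ((t / n.+1%:R) `^ s *
    (c * cos (u * ln (t / n.+1%:R)) + d * sin (u * ln (t / n.+1%:R))))).
Proof.
move=> t0; have n0 : 0 < n.+1%:R :> R by [].
have N0 : n.+1%:R `^ s != 0 :> R by rewrite gt_eqF// powR_gt0.
rewrite /gpart mul0r cos0 mul0r mulr1 addr0 mulr1.
rewrite powRD ?(gt_eqF t0) ?implybT// ln_div ?posrE// mulrBr cosB sinB.
by rewrite powRM ?invr_ge0 ?(ltW t0)// -powR_inv1 ?(ltW n0)// -powRrM mulN1r powRN; field.
Qed.

(** For z = s + iu, the pairs (1, 0) and (0, 1) give the real and imaginary parts of Gamma(n+1+z) /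
    (n! (n+1)^z). *)
Definition gratio s u n (c d : R) : R :=
  Gpart (n%:R + s) u (c * cos (u * ln n.+1%:R) - d * sin (u * ln n.+1%:R))
    (c * sin (u * ln n.+1%:R) + d * cos (u * ln n.+1%:R)) / (n`!%:R * n.+1%:R `^ s).

Lemma gratio_cvg s u : 1 <= s ->
  gratio s u n 1 0 @[n --> \oo] --> (1 : R) /\ gratio s u n 0 1 @[n --> \oo] --> (0 : R).
Proof.
move=> s1; have [K [m [K0 hK]]] := cpow_sub1_le u s1.
have mI : measurable pos_itv by exact: measurable_pos_itv.
have nN1 k : -1 < k%:R :> R by rewrite (lt_le_trans (ltrN10 _)).
have nsN1 k : -1 < k%:R + s :> R by rewrite (lt_le_trans (nN1 k))// lerDl; lra.
have n0 k : 0 < k.+1%:R :> R by [].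
have N0 k : k.+1%:R `^ s != 0 :> R by rewrite gt_eqF// powR_gt0.
have F0 k : k`!%:R != 0 :> R by rewrite pnatr_eq0 -lt0n fact_gt0.
pose A n c d := c * cos (u * ln n.+1%:R) - d * sin (u * ln n.+1%:R) : R.
pose B n c d := c * sin (u * ln n.+1%:R) + d * cos (u * ln n.+1%:R) : R.
have iZ n (r : R) c d : mu.-integrable pos_itv (EFin \o (fun t : R =>
    r * gpart (n%:R + s) u (A n c d) (B n c d) t)).
  rewrite (_ : EFin \o _ = (fun t => r%:E *
     (EFin \o gpart (n%:R + s) u (A n c d) (B n c d)) t)%E)//.
  by apply: integrableZl => //; exact: gpart_integrable.
have g0 n (t : R) : 0 <= gpart n%:R 0 1 0 t.
  by rewrite /gpart mul0r cos0 mul0r mulr1 addr0 mulr1 mulr_ge0 ?powR_ge0 ?expR_ge0.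
split.
  (* Subtracting t^n e^(-t), whose integral is n!, leaves the density times the real part of
     y^(s+iu) - 1 at y = t / (n+1), to which [concentration] applies. *)
  pose f n (t : R) := (n.+1%:R `^ s)^-1 * gpart (n%:R + s) u (A n 1 0) (B n 1 0) t
    - gpart n%:R 0 1 0 t.
  have fi n : mu.-integrable pos_itv (EFin \o f n).
    rewrite (_ : EFin \o _ = ((EFin \o (fun t : R => (n.+1%:R `^ s)^-1 *
      gpart (n%:R + s) u (A n 1 0) (B n 1 0) t)%R) \- (EFin \o gpart n%:R 0 1 0))%E)//.
    by apply: integrableB => //; exact: gpart_integrable.
  have := @concentration K m f K0 _ fi.
  have -> : (fun n => (n`!%:R)^-1 * \int[mu]_(t in pos_itv) f n t) =
            (fun n => gratio s u n 1 0 - 1).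
    apply/funext => n; rewrite /f RintegralB//; last exact: gpart_integrable.
    rewrite RintegralZl//; last exact: gpart_integrable.
    rewrite -/(Gpart _ _ _ _) -/(Gpart _ _ _ _) Gpart_natr /gratio -/(A n 1 0) -/(B n 1 0).
    by field; rewrite N0 F0.
  move=> /(_ _) h; rewrite -[X in _ --> X]addr0.
  have -> : (fun n => gratio s u n 1 0) = (fun n => 1 + (gratio s u n 1 0 - 1)).
    by apply/funext => n; rewrite addrC subrK.
  apply: cvgD; first exact: cvg_cst.
  apply: h => n t t0; rewrite /f /A /B gpart_shift// mulKf//.
  have y0 : 0 < t / n.+1%:R by rewrite divr_gt0.
  rewrite mul1r mul0r addr0 -{2}[gpart n%:R 0 1 0 t]mulr1 -mulrBr normrM ger0_norm//.
  by rewrite ler_wpM2l//; have [] := hK _ y0.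
pose f n (t : R) := (n.+1%:R `^ s)^-1 * gpart (n%:R + s) u (A n 0 1) (B n 0 1) t.
have fi n : mu.-integrable pos_itv (EFin \o f n) by exact: iZ.
have := @concentration K m f K0 _ fi.
have -> : (fun n => (n`!%:R)^-1 * \int[mu]_(t in pos_itv) f n t) =
          (fun n => gratio s u n 0 1).
  apply/funext => n; rewrite /f RintegralZl//; last exact: gpart_integrable.
  rewrite -/(Gpart _ _ _ _) /gratio -/(A n 0 1) -/(B n 0 1).
  by field; rewrite N0 F0.
apply => n t t0; rewrite /f /A /B gpart_shift// mulKf//.
have y0 : 0 < t / n.+1%:R by rewrite divr_gt0.
rewrite mul0r mul1r add0r normrM ger0_norm//.
by rewrite ler_wpM2l//; have [] := hK _ y0.
Qed.

End Gamma_asymptotics.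

(** * Limits of complex sequences *)

Section complex_limits.
Local Open Scope classical_set_scope.
Variable R : realType.
Implicit Types (f g : nat -> R[i]) (l : R[i]).

Definition ccvg f l := (f : nat -> R[i]^o) @ \oo --> (l : R[i]^o).

Lemma ccvg_unique f l l' : ccvg f l -> ccvg f l' -> l = l'.
Proof. exact: (@cvg_unique _ (@norm_hausdorff _ R[i]^o)). Qed.

Lemma ccvg_cst l : ccvg (fun=> l) l.
Proof. exact: cvg_cst. Qed.

Lemma ccvgD f g l l' : ccvg f l -> ccvg g l' -> ccvg (fun n => f n + g n) (l + l').
Proof. exact: (@cvgD _ R[i]^o). Qed.

Lemma ccvgM f g l l' : ccvg f l -> ccvg g l' -> ccvg (fun n => f n * g n) (l * l').
Proof. exact: (@cvgM R[i]). Qed.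

Lemma ccvgV f l : l != 0 -> ccvg f l -> ccvg (fun n => (f n)^-1) l^-1.
Proof. exact: (@cvgV R[i]). Qed.

Lemma ccvg_prod k (f : nat -> nat -> R[i]) (l : nat -> R[i]) :
  (forall j, ccvg (f j) (l j)) ->
  ccvg (fun n => \prod_(0 <= j < k) f j n) (\prod_(0 <= j < k) l j).
Proof.
move=> fl; rewrite /ccvg; apply: (@cvg_big R[i]^o) => [|j _]; last exact: fl.
exact: (@mul_continuous R[i]).
Qed.

Lemma ccvg_eq f g l l' : ccvg f l -> f =1 g -> l = l' -> ccvg g l'.
Proof. by move=> fl /funext <- <-. Qed.

Lemma ccvg_subseq f l (h : nat -> nat) : (forall n, (n <= h n)%N) ->
  ccvg f l -> ccvg (f \o h) l.
Proof.
move=> hn; apply: cvg_comp => A [N _ NA]; exists N => // n Nn.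
by apply: NA; exact: leq_trans (hn n).
Qed.

Lemma ccvg_even_odd f l : ccvg (fun n => f n.*2) l -> ccvg (fun n => f n.*2.+1) l ->
  ccvg f l.
Proof.
move=> fe fo A lA; have [N1 _ h1] := fe A lA; have [N2 _ h2] := fo A lA.
exists (maxn N1 N2).*2.+1 => // n /= Nn.
rewrite /= -(odd_double_half n); case: (odd n); rewrite ?add1n ?add0n.
  apply: h2; rewrite /= -(doubleK N2) half_leq// (leq_trans _ (ltnW Nn))//.
  by rewrite leq_double leq_maxr.
apply: h1; rewrite /= -(doubleK N1) half_leq// (leq_trans _ (ltnW Nn))//.
by rewrite leq_double leq_maxl.
Qed.

Lemma ccvg_parts (u v : nat -> R) (a b : R) :
  u @ \oo --> a -> v @ \oo --> b -> ccvg (fun n => u n +i* v n) (a +i* b).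
Proof.
move=> ua vb; apply/(@cvgrPdist_lt _ R[i]^o) => -[e e'].
(* A positive element of [R[i]] has imaginary part 0, so the radius is real. *)
rewrite ltcE /= => /andP[/eqP -> e0].
have e2 : 0 < e / 2 by rewrite divr_gt0.
move/cvgrPdist_lt : ua => /(_ _ e2) ua; move/cvgrPdist_lt : vb => /(_ _ e2) vb.
near=> n.
have -> : a +i* b - (u n +i* v n) = (a - u n)%:C + (b - v n)%:C * 'i.
  by rewrite [LHS]complexE mulrC /=.
apply: (le_lt_trans (ler_normD _ _)); rewrite normrM.
have -> : `|'i : R[i]| = 1 by rewrite normc_def /= expr0n /= add0r expr1n sqrtr1.
have nC (r : R) : `|r%:C| = `|r|%:C by rewrite normc_def /= expr0n /= addr0 sqrtr_sqr.
rewrite mulr1 !nC -rmorphD ltcR [ltRHS](splitr e) ltrD//; near: n.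
Unshelve. all: by end_near. Qed.

Lemma ccvg_real (u : nat -> R) (a : R) : u @ \oo --> a -> ccvg (fun n => (u n)%:C) a%:C.
Proof. by move=> ua; apply: ccvg_parts => //; exact: cvg_cst. Qed.

Lemma ccvg_divS (z : R[i]) : ccvg (fun n => 1 + z / n.+1%:R) 1.
Proof.
have h := ccvgM (@ccvg_cst z) (ccvg_real (@cvg_harmonic R)).
apply: (ccvg_eq (ccvgD (@ccvg_cst 1) h)); last by rewrite mulr0 addr0.
by move=> n /=; rewrite fmorphV rmorph_nat.
Qed.

End complex_limits.

(** * The complex exponential *)

Section complex_exponential.
Variable R : realType.
Implicit Types z w : R[i].

Lemma cexpD z w : cexp (z + w) = cexp z * cexp w.
Proof.
case: z w => a b [c d]; rewrite /cexp /= !realM_complex expRD cosD sinD.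
by apply/eqP; rewrite eq_complex /=; apply/andP; split; apply/eqP; ring.
Qed.

Lemma cexp_real (a : R) : cexp a%:C = (expR a)%:C.
Proof. by rewrite /cexp /= cos0 sin0 realM_complex mulr1 mulr0. Qed.

Lemma cexpN z : cexp (- z) = (cexp z)^-1.
Proof.
have e : cexp z * cexp (- z) = 1 by rewrite -cexpD subrr -[0]/(0%:C) cexp_real expR0.
have z0 : cexp z != 0.
  by apply/eqP => z0; move/eqP: e; rewrite z0 mul0r eq_sym oner_eq0.
by apply: (mulfI z0); rewrite e divff.
Qed.

Lemma cexp_neq0 z : cexp z != 0.
Proof.
apply/eqP => z0; have := cexpD z (- z).
rewrite subrr -[0]/(0%:C) cexp_real expR0 z0 mul0r => /eqP.
by rewrite oner_eq0.
Qed.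

Lemma ccvg_cexp z (h : nat -> R) (a : R) : (h @ \oo --> a)%classic ->
  ccvg (fun n => cexp (z * (h n)%:C)) (cexp (z * a%:C)).
Proof.
case: z => s u ha.
have e r : cexp ((s +i* u) * r%:C) = (expR (s * r) * cos (u * r)) +i* (expR (s * r) * sin (u * r)).
  by rewrite mulrC realM_complex /cexp /= realM_complex !(mulrC r).
apply: (@ccvg_eq _ (fun n => (expR (s * h n) * cos (u * h n)) +i* (expR (s * h n) * sin (u * h n)))
  _ ((expR (s * a) * cos (u * a)) +i* (expR (s * a) * sin (u * a)))); last 2 first.
- by move=> n; rewrite e.
- by rewrite e.
have hc c : (c * h n @[n --> \oo] --> c * a)%classic by apply: cvgM; [exact: cvg_cst|].
by apply: ccvg_parts; apply: cvgM; apply: continuous_cvg;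
  [exact: continuous_expR| |exact: continuous_cos| |
   exact: continuous_expR| |exact: continuous_sin| ].
Qed.

End complex_exponential.

(** * Asymptotics and non-vanishing of Gamma for complex arguments *)

Section Gamma_limit.
Variable R : realType.
Implicit Types (z : R[i]) (n : nat).

Lemma Re_natrD n z : complex.Re (n%:R + z) = n%:R + complex.Re z.
Proof. by rewrite -[n%:R in LHS](rmorph_nat (real_complex R)); case: z. Qed.

Lemma Im_natrD n z : complex.Im (n%:R + z) = complex.Im z.
Proof.
by rewrite -[n%:R in LHS](rmorph_nat (real_complex R)); case: z => a b /=; rewrite add0r.
Qed.

(** The quotient Gamma(n+1+z) / (n! (n+1)^z), with the complex power written as an exponential. *)
Definition Gamma_ratio z n : R[i] :=
  cexp (- (z * (ln n.+1%:R)%:C)) * Gamma (n.+1%:R + z) / (n`!%:R)%:C.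

Lemma Gamma_ratioE z n : 0 < complex.Re z -> Gamma_ratio z n =
  gratio (complex.Re z) (complex.Im z) n 1 0 +i* gratio (complex.Re z) (complex.Im z) n 0 1.
Proof.
rewrite /Gamma_ratio GammaE Re_natrD Im_natrD; case: z => s u /= s0.
have -> : n.+1%:R + s - 1 = n%:R + s by rewrite -natr1; ring.
have n1 : -1 < n%:R + s by rewrite (lt_le_trans (ltrN10 _))// addr_ge0// ltW.
have -> : - ((s +i* u) * (ln n.+1%:R)%:C) = (- (s * ln n.+1%:R)) +i* (- (u * ln n.+1%:R)).
  by rewrite mulrC realM_complex !(mulrC (ln _)).
have -> : ((n`!%:R)%:C)^-1 = ((n`!%:R)^-1)%:C :> R[i] by rewrite fmorphV.
rewrite mulrC /cexp /= cosN sinN [X in _ * (X * _)]realM_complex.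
rewrite [X in _ * X]mul_complexE realM_complex.
have N0 : n.+1%:R `^ s != 0 :> R by rewrite gt_eqF// powR_gt0.
have F0 : n`!%:R != 0 :> R by rewrite pnatr_eq0 -lt0n fact_gt0.
have -> : expR (- (s * ln n.+1%:R)) = (n.+1%:R `^ s)^-1 by rewrite expRN /powR gt_eqF.
set C := cos _; set S := sin _.
have -> : gratio s u n 1 0 = Gpart (n%:R + s) u C S / (n`!%:R * n.+1%:R `^ s).
  by rewrite /gratio -/C -/S; congr (Gpart _ _ _ _ / _); ring.
have -> : gratio s u n 0 1 = Gpart (n%:R + s) u (- S) C / (n`!%:R * n.+1%:R `^ s).
  by rewrite /gratio -/C -/S; congr (Gpart _ _ _ _ / _); ring.
have e1 : Gpart (n%:R + s) u C S = C * Gpart (n%:R + s) u 1 0 + S * Gpart (n%:R + s) u 0 1.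
  by rewrite -GpartZD//; congr Gpart; ring.
have e2 : Gpart (n%:R + s) u (- S) C = - S * Gpart (n%:R + s) u 1 0 + C * Gpart (n%:R + s) u 0 1.
  by rewrite -GpartZD//; congr Gpart; ring.
rewrite e1 e2.
by congr (_ +i* _); field; rewrite N0 F0.
Qed.

Lemma Gamma_ratioS z n : 0 < complex.Re z ->
  Gamma_ratio (z + 1) n = Gamma_ratio z n * (1 + z / n.+1%:R).
Proof.
move=> z0; have n0 : n.+1%:R != 0 :> R[i] by rewrite pnatr_eq0.
rewrite /Gamma_ratio addrA GammaS; last by rewrite Re_natrD addr_gt0.
rewrite mulrDl mul1r opprD cexpD.
have -> : cexp (- (ln n.+1%:R)%:C) = (n.+1%:R)^-1 :> R[i].
  by rewrite cexpN cexp_real lnK ?posrE// rmorph_nat.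
have F0 : n`!%:R != 0 :> R[i] by rewrite pnatr_eq0 -lt0n fact_gt0.
rewrite rmorph_nat; move: (n.+1%:R : R[i]) (n`!%:R : R[i]) n0 F0 => N F N0 F0.
by field; rewrite N0 F0.
Qed.

(** [gratio_cvg] requires a real part at least 1. It is applied at z + 1, and the functional
    equation brings the limit back to z through the factor 1 + z/(n+1), which tends to 1. *)
Lemma Gamma_ratio_cvg z : 0 < complex.Re z -> ccvg (Gamma_ratio z) 1.
Proof.
move=> z0; have z1 : 1 <= complex.Re (z + 1) by case: z z0 => a b /= /ltW; rewrite lerDr.
have [h1 h2] := gratio_cvg (complex.Im (z + 1)) z1.
have h : ccvg (Gamma_ratio (z + 1)) 1.
  apply: (ccvg_eq (ccvg_parts h1 h2)) => // n.
  by rewrite Gamma_ratioE// (lt_le_trans _ z1).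
have h' := ccvgM h (ccvgV (oner_neq0 _) (ccvg_divS z)).
apply: (ccvg_eq h'); last by rewrite invr1 mulr1.
move=> n; rewrite Gamma_ratioS// mulfK//.
have n0 : n.+1%:R != 0 :> R[i] by rewrite pnatr_eq0.
have : n.+1%:R + z != 0.
  apply/eqP => e; have := Re_natrD n.+1 z; rewrite e /= => /esym/eqP.
  by rewrite gt_eqF// addr_gt0.
apply: contraNneq => e; rewrite -[X in X + z]mulr1 -[z](divfK n0) mulrC -mulrDl.
by rewrite [X in X * _](_ : _ = 0) ?mul0r// e.
Qed.

(** By the functional equation a zero at z propagates to every z + n; [Gamma_ratio z] would then
    vanish identically, although it tends to 1. *)
Lemma Gamma_neq0 z : 0 < complex.Re z -> Gamma z != 0.
Proof.
move=> z0; apply/eqP => G0.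
have Gn n : Gamma (n%:R + z) = 0.
  elim: n => [|n IH]; first by rewrite add0r.
  have -> : n.+1%:R + z = (n%:R + z) + 1 by rewrite -natr1 addrAC.
  by rewrite GammaS ?IH ?mulr0// Re_natrD ltr_wpDl.
have h : ccvg (Gamma_ratio z) 0.
  apply: (ccvg_eq (@ccvg_cst R 0)) => // n.
  by rewrite /Gamma_ratio Gn mulr0 mul0r.
have /eqP := ccvg_unique h (Gamma_ratio_cvg z0).
by rewrite eq_sym oner_eq0.
Qed.

End Gamma_limit.

(** * The alternating product *)

Section alternating_product.
Variable R : realType.
Implicit Types (x y : R[i]) (M k n p : nat).

Lemma sign_double M : (((-1) ^+ M.*2.+1 = -1 :> int) * ((-1) ^+ M.*2.+2 = 1 :> int) *
  ((-1) ^+ M.*2.+3 = -1 :> int))%type.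
Proof.
have e : (-1) ^+ M.*2 = 1 :> int by rewrite -signr_odd odd_double.
by rewrite !exprS e !mulr1 mulN1r opprK.
Qed.

(** The index starts at 0, so x^-1 is included and the number 2M + 1 of factors is odd, as the
    splitting into residue classes modulo an odd n requires. *)
Definition altprod M x : R[i] :=
  \prod_(0 <= k < M.*2.+1) (x + k%:R) ^ ((-1) ^+ k.+1 : int).

Lemma altprod0 x : altprod 0 x = x^-1.
Proof. by rewrite /altprod big_nat1 addr0 expr1 exprN1. Qed.

Lemma altprodS M x :
  altprod M.+1 x = altprod M x * (x + M.*2.+1%:R) / (x + M.*2.+2%:R).
Proof.
rewrite /altprod doubleS big_nat_recr//= [X in X * _]big_nat_recr//=.
by rewrite !sign_double expr1z exprN1.
Qed.

Lemma prod_sign (c : R[i]) M : c != 0 ->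
  \prod_(0 <= k < M.*2.+1) c ^ ((-1) ^+ k.+1 : int) = c^-1.
Proof.
move=> c0; elim: M => [|M IH]; first by rewrite big_nat1 expr1 exprN1.
rewrite doubleS big_nat_recr//= [X in X * _]big_nat_recr//= IH.
by rewrite !sign_double expr1z exprN1 mulVf// mul1r.
Qed.

Lemma prod_sign_odd (c : R[i]) n : c != 0 -> odd n ->
  \prod_(0 <= j < n) c ^ ((-1) ^+ j : int) = c.
Proof.
move=> c0 odn; have nE : n = n./2.*2.+1 by rewrite -[LHS]odd_double_half odn.
have c0' : c^-1 != 0 by rewrite invr_eq0.
rewrite -[RHS]invrK -(prod_sign n./2 c0') -nE; apply: eq_bigr => j _.
by rewrite exprS mulN1r exprz_inv opprK.
Qed.

Lemma addr_natr_neq0 x n : 0 < complex.Re x -> x + n%:R != 0.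
Proof.
move=> x0; apply/eqP => e; have := Re_natrD n x; rewrite addrC e /= => /esym/eqP.
by rewrite gt_eqF// ltr_wpDl.
Qed.

Definition Gamma_half_ratio x : R[i] := Gamma (x / 2) / Gamma (x / 2 + 2^-1) / 2.

Lemma Re_half x : complex.Re (x / 2) = complex.Re x / 2.
Proof.
rewrite -(rmorph_nat (real_complex R)) -fmorphV mulrC; case: x => a b.
by rewrite realM_complex /= mulrC.
Qed.

Lemma Re_addhalf x : complex.Re (x + 2^-1) = complex.Re x + 2^-1.
Proof. by rewrite -(rmorph_nat (real_complex R)) -fmorphV; case: x. Qed.

(** With y = x/2, the new factors are x + 2M + 1 = 2 (M + y + 1/2) and x + 2M + 2 = 2 (M + 1 + y).
    The factors 2 cancel, and the functional equation absorbs the rest into the two Gamma values. *)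
Lemma altprod_Gamma M x : 0 < complex.Re x -> altprod M x = Gamma_half_ratio x *
  (Gamma (M%:R + (x / 2 + 2^-1)) / Gamma (M.+1%:R + x / 2)).
Proof.
move=> x0; have y0 : 0 < complex.Re (x / 2) by rewrite Re_half divr_gt0.
have y0' : 0 < complex.Re (x / 2 + 2^-1) by rewrite Re_addhalf addr_gt0 ?invr_gt0.
have xE : x = 2 * (x / 2) by rewrite mulrC divfK// pnatr_eq0.
rewrite /Gamma_half_ratio; move: (x / 2) y0 y0' xE => y y0 y0' ->.
have G0 := Gamma_neq0 y0; have G0' := Gamma_neq0 y0'.
have yn0 : y != 0 by have := addr_natr_neq0 0 y0; rewrite addr0.
elim: M => [|M IH].
  rewrite altprod0 add0r (addrC 1 y) GammaS//; field.
  by rewrite yn0 G0 G0'.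
rewrite altprodS IH.
have -> : M.+1%:R + (y + 2^-1) = M%:R + (y + 2^-1) + 1 by rewrite -natr1 addrAC.
have -> : M.+2%:R + y = M.+1%:R + y + 1 by rewrite -natr1 addrAC.
rewrite !GammaS ?Re_natrD ?ltr_wpDl//.
have G1 : Gamma (M.+1%:R + y) != 0 by rewrite Gamma_neq0// Re_natrD ltr_wpDl.
have := addr_natr_neq0 M.+1 y0.
have -> : 2 * y + M.*2.+1%:R = 2 * (M%:R + (y + 2^-1)).
  by rewrite -[M.*2.+1%:R]natr1 -muln2 natrM; field.
have -> : 2 * y + M.*2.+2%:R = 2 * (M.+1%:R + y).
  by rewrite -doubleS -muln2 natrM; ring.
rewrite addrC => h; field.
by rewrite G0' G1 (addrC 1) natr1 h.
Qed.

Lemma altprod_cvg x : 0 < complex.Re x ->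
  ccvg (fun M => (Num.sqrt M.+1%:R)%:C * altprod M x) (Gamma_half_ratio x).
Proof.
move=> x0; pose y := x / 2.
have y0 : 0 < complex.Re y by rewrite Re_half divr_gt0.
have y0' : 0 < complex.Re (y + 2^-1) by rewrite Re_addhalf addr_gt0 ?invr_gt0.
have h1 := ccvgM (Gamma_ratio_cvg y0') (ccvgV (oner_neq0 _) (Gamma_ratio_cvg y0)).
(* [Gamma_ratio] involves Gamma(M + 1 + y + 1/2), one step beyond the value in [altprod_Gamma]; the
   correction is (M + y + 1/2) / (M + 1) = 1 + (y - 1/2) / (M + 1). *)
have h2 := ccvgM h1 (ccvgV (oner_neq0 _) (ccvg_divS (y - 2^-1))).
have h3 := ccvgM (@ccvg_cst R (Gamma_half_ratio x)) h2.
apply: (ccvg_eq h3); last by rewrite invr1 !mulr1.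
move=> M; rewrite altprod_Gamma// -/y [RHS]mulrCA; congr (_ * _).
have [s0 sE] : (Num.sqrt M.+1%:R)%:C != 0 :> R[i] /\
    (Num.sqrt M.+1%:R)%:C ^+ 2 = M.+1%:R :> R[i].
  rewrite -rmorphXn /= sqr_sqrtr// rmorph_nat; split=> //.
  by rewrite -[0]/(0%:C) (inj_eq (@complexI _)) sqrtr_eq0 -ltNge.
rewrite /Gamma_ratio.
have -> : - ((y + 2^-1) * (ln M.+1%:R)%:C) =
    - (y * (ln M.+1%:R)%:C) + - (2^-1 * ln M.+1%:R)%:C :> R[i].
  by rewrite rmorphM fmorphV rmorph_nat /=; ring.
rewrite cexpD.
have -> : cexp (- (2^-1 * ln M.+1%:R)%:C) = ((Num.sqrt M.+1%:R)%:C)^-1 :> R[i].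
  rewrite cexpN cexp_real -powR12_sqrt// /powR gt_eqF//.
have -> : M.+1%:R + (y + 2^-1) = M%:R + (y + 2^-1) + 1 by rewrite -natr1 addrAC.
rewrite GammaS ?Re_natrD ?ltr_wpDl//.
have G1 : Gamma (M.+1%:R + y) != 0 by rewrite Gamma_neq0// Re_natrD ltr_wpDl.
have m0 : M.+1%:R != 0 :> R[i] by rewrite pnatr_eq0.
have -> : 1 + (y - 2^-1) / M.+1%:R = (M%:R + (y + 2^-1)) / M.+1%:R.
  have -> : M%:R = M.+1%:R - 1 :> R[i] by rewrite -natr1 addrK.
  by move: (M.+1%:R : R[i]) m0 => N N0; field.
have h0 : M%:R + (y + 2^-1) != 0 by rewrite addrC addr_natr_neq0.
have F0 : (M`!%:R)%:C != 0 :> R[i] by rewrite rmorph_nat pnatr_eq0 -lt0n fact_gt0.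
have c0 := cexp_neq0 (- (y * (ln M.+1%:R)%:C)).
move: (Gamma (M%:R + (y + 2^-1))) (Gamma (M.+1%:R + y)) G1 => A B G1.
rewrite -sE; move: (M`!%:R)%:C (cexp (- (y * _))) (M%:R + (y + 2^-1)) (Num.sqrt M.+1%:R)%:C
  F0 c0 h0 s0 => F c C s F0 c0 h0 s0.
by field; rewrite F0 c0 G1 h0 s0.
Qed.

Lemma Gamma_half_ratio1 : Gamma_half_ratio 1 = (Num.sqrt pi : R)%:C / 2.
Proof.
rewrite /Gamma_half_ratio mul1r Gamma_half.
have -> : 2^-1 + 2^-1 = 1 :> R[i] by field.
by rewrite (Gamma_natS R 0) fact0 divr1.
Qed.

Lemma Gamma_half_ratio_neq0 x : 0 < complex.Re x -> Gamma_half_ratio x != 0.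
Proof.
move=> x0; have y0 : 0 < complex.Re (x / 2) by rewrite Re_half divr_gt0.
have y0' : 0 < complex.Re (x / 2 + 2^-1) by rewrite Re_addhalf addr_gt0 ?invr_gt0.
by rewrite !mulf_neq0 ?invr_eq0 ?Gamma_neq0// pnatr_eq0.
Qed.

(** Write k = i n + j with j < n. Then n x + k = n (x + j/n + i), and (-1)^(k+1) = (-1)^(i+1) (-1)^j
    because n is odd. The extracted factors n have one more negative exponent than positive ones,
    which leaves n^-1. *)
Lemma altprod_mul p M x : let n := p.*2.+1 in
  altprod (n * M + p) (n%:R * x) =
  n%:R^-1 * \prod_(0 <= j < n) altprod M (x + j%:R / n%:R) ^ ((-1) ^+ j : int).
Proof.
set n := p.*2.+1 => /=; have n0 : n%:R != 0 :> R[i] by rewrite pnatr_eq0.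
transitivity ((\prod_(0 <= k < (n * M + p).*2.+1) n%:R ^ ((-1) ^+ k.+1 : int)) *
  \prod_(0 <= j < n) altprod M (x + j%:R / n%:R) ^ ((-1) ^+ j : int)); last by rewrite prod_sign.
rewrite {1}/altprod.
under eq_bigr => k _.
  rewrite (_ : n%:R * x + k%:R = n%:R * (x + k%:R / n%:R)); last by field.
  rewrite expfzMl; over.
rewrite big_split /=; congr (_ * _).
have -> : (n * M + p).*2.+1 = (M.*2.+1 * n)%N by rewrite /n; lia.
rewrite big_nat_mul.
under eq_bigr => i _.
  rewrite -{1}[(i * n)%N]add0n big_addn mulSn addnK; over.
rewrite exchange_big_nat /=; apply: eq_bigr => j _.
rewrite /altprod (big_morph (fun z : R[i] => z ^ ((-1) ^+ j : int))
  (fun a b => expfzMl a b _) (exp1rz _ _)).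
apply: eq_bigr => i _; rewrite exprz_exp; congr (_ ^ _).
  by rewrite natrD natrM; field.
rewrite -signr_odd /= oddD oddM /n /= odd_double /= andbT.
by rewrite -[in RHS]signr_odd -[X in _ * X]signr_odd -signr_addb /= addbC addNb.
Qed.

End alternating_product.

(** * Evaluation of Gammat *)

Section Gammat_limit.
Variable R : realType.
Implicit Types (x : R[i]) (M n : nat).

(** * The alternating harmonic series and log 2 *)

Definition altharmonic M : R := \sum_(0 <= i < M) (i.*2.+1%:R^-1 - i.*2.+2%:R^-1).

Lemma altharmonicE M : altharmonic M = \sum_(M <= k < M.*2) k.+1%:R^-1.
Proof.
rewrite /altharmonic; elim: M => [|M IH]; first by rewrite !big_nil.
rewrite big_nat_recr//= IH doubleS.
have [->|M0] := posnP M; first by rewrite !double0 big_nil big_nat1 add0r; field.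
have e1 : \sum_(M <= k < M.*2.+2) k.+1%:R^-1 = \sum_(M <= k < M.*2) k.+1%:R^-1 +
  M.*2.+1%:R^-1 + M.*2.+2%:R^-1 :> R.
  by rewrite !big_nat_recr//= ?leqW// -addnn leq_addr.
have e2 : \sum_(M <= k < M.*2.+2) k.+1%:R^-1 = M.+1%:R^-1 +
    \sum_(M.+1 <= k < M.*2.+2) k.+1%:R^-1 :> R.
  by rewrite big_ltn// -addnn; lia.
have -> : \sum_(M.+1 <= k < M.*2.+2) k.+1%:R^-1 = \sum_(M <= k < M.*2) k.+1%:R^-1 +
    M.*2.+1%:R^-1 + M.*2.+2%:R^-1 - M.+1%:R^-1 :> R.
  by rewrite -e1 e2 addrAC subrr add0r.
have -> : M.*2.+2%:R = 2 * M.+1%:R :> R by rewrite -natrM; congr (_%:R); lia.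
have : M.+1%:R != 0 :> R by rewrite pnatr_eq0.
by move: (M.+1%:R : R) (M.*2.+1%:R^-1 : R) (\sum_(_ <= _ < _) _) => N a S N0; field.
Qed.

Lemma ln_succ_le (k : nat) : (0 < k)%N -> ln k.+1%:R - ln k%:R <= k%:R^-1 :> R.
Proof.
move=> k0; rewrite -ln_div ?posrE ?ltr0n// -natr1 mulrDl divff ?pnatr_eq0 -?lt0n// mul1r.
by apply: le_ln1Dx; rewrite (lt_le_trans (ltrN10 _))// invr_ge0.
Qed.

Lemma ln_succ_ge (k : nat) : (0 < k)%N -> k.+1%:R^-1 <= ln k.+1%:R - ln k%:R :> R.
Proof.
move=> k0; rewrite -lerN2 opprB -ln_div ?posrE ?ltr0n//.
have -> : k%:R / k.+1%:R = 1 + - k.+1%:R^-1 :> R.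
  by rewrite -[in LHS](addrK 1 k%:R) natr1; field.
by apply: le_ln1Dx; rewrite ltrN2 invf_lt1 ?ltr1n.
Qed.

(** In the form 1/(M+1) + ... + 1/(2M), the sum lies between two telescoping sums of logarithms,
    equal to ln((2M+1)/(M+1)) and ln(2M/M). *)
Lemma altharmonic_cvg : (altharmonic M @[M --> \oo] --> (ln 2 : R))%classic.
Proof.
apply: (@squeeze_cvgr _ _ _ _ (fun M => ln (2 - M.+1%:R^-1)) (fun=> ln 2)).
- near=> M; have M0 : (0 < M)%N by near: M; exists 1%N.
  rewrite altharmonicE; apply/andP; split.
    have -> : 2 - M.+1%:R^-1 = M.*2.+1%:R / M.+1%:R :> R.
      have -> : M.*2.+1%:R = 2 * M.+1%:R - 1 :> R.
        by rewrite -[M.+1%:R]natr1 -addn1 natrD -muln2 natrM; ring.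
      by field.
    rewrite ln_div ?posrE//.
    apply: (@le_trans _ _ (\sum_(M <= k < M.*2) (ln k.+2%:R - ln k.+1%:R))).
      by rewrite (telescope_sumr (fun k => ln k.+1%:R))// -addnn leq_addr.
    by apply: ler_sum => k _; exact: ln_succ_le.
  apply: (@le_trans _ _ (\sum_(M <= k < M.*2) (ln k.+1%:R - ln k%:R))).
    by apply: ler_sum_nat => k /andP[Mk _]; apply: ln_succ_ge; exact: leq_trans Mk.
  rewrite (telescope_sumr (fun k => ln k%:R)); last by rewrite -addnn leq_addr.
  rewrite -ln_div ?posrE ?ltr0n ?double_gt0//.
  by rewrite -muln2 natrM mulrAC divff ?mul1r// pnatr_eq0 -lt0n.
- have e : 2 = 2 - 0 :> R by rewrite subr0.
  apply: continuous_cvg; first exact: continuous_ln.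
  rewrite [X in (_ --> X)%classic]e; apply: cvgB; [exact: cvg_cst|exact: cvg_harmonic].
- exact: cvg_cst.
Unshelve. all: by end_near. Qed.

(** The factor x cancels the term k = 0 of [altprod M x]. Clearing the denominators of 1 + x/k
    leaves the product of (2i+2)/(2i+1) over i < M, which is (2M+1) [altprod M 1]. *)
Lemma Gammat_partial_even x M : 0 < complex.Re x ->
  Gammat_partial x M.*2 = cexp (- x * (altharmonic M)%:C) * x * altprod M x *
    (M.*2.+1%:R * altprod M 1).
Proof.
move=> x0; have xn0 n : x + n%:R != 0 by exact: addr_natr_neq0.
have x00 : x != 0 by have := xn0 0%N; rewrite addr0.
rewrite /Gammat_partial; elim: M => [|M IH].
  rewrite big_nil /altharmonic big_nil mulr0 -[0]/(0%:C) cexp_real expR0 !altprod0.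
  by rewrite invr1 mul1r !mulr1 divff.
rewrite doubleS big_nat_recr//= big_nat_recr//= IH !altprodS.
rewrite !sign_double expr1z exprN1.
rewrite /altharmonic big_nat_recr//= -/(altharmonic M) !rmorphD rmorphN !fmorphV !rmorph_nat /=.
have -> : cexp (- x * ((altharmonic M)%:C + (M.*2.+1%:R^-1 - M.*2.+2%:R^-1))) =
    cexp (- x * (altharmonic M)%:C) * cexp (- x / M.*2.+1%:R) / cexp (- x / M.*2.+2%:R).
  by rewrite mulrDr mulrBr !cexpD cexpN mulrA.
have c0 := cexp_neq0 (- x / M.*2.+2%:R).
have -> : 1 + M.*2.+1%:R = M.*2.+2%:R :> R[i] by rewrite nat1r.
have := xn0 M.*2.+1; have := xn0 M.*2.+2.
have m1 : M.*2.+1%:R != 0 :> R[i] by rewrite pnatr_eq0.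
have m2 : M.*2.+2%:R != 0 :> R[i] by rewrite pnatr_eq0.
have m3 : M.*2.+3%:R != 0 :> R[i] by rewrite pnatr_eq0.
have -> : 1 + M.*2.+2%:R = M.*2.+3%:R :> R[i] by rewrite nat1r.
move: (cexp (- x * (altharmonic M)%:C)) (cexp (- x / M.*2.+1%:R))
  (cexp (- x / M.*2.+2%:R)) c0 => c1 c2 c3 c0.
move: (altprod M x) (altprod M 1) (M.*2.+1%:R : R[i]) (M.*2.+2%:R : R[i])
  (M.*2.+3%:R : R[i]) m1 m2 m3 => A B N1 N2 N3 m1 m2 m3 h2 h1.
by field; rewrite c0 m1 m2 m3 h2.
Qed.

Lemma Gammat_partial_cvg x : 0 < complex.Re x -> ccvg (Gammat_partial x)
  (cexp (- x * (ln 2)%:C) * x * ((Num.sqrt pi)%:C * Gamma_half_ratio x)).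
Proof.
move=> x0; have x10 : 0 < complex.Re (1 : R[i]) by rewrite /= ltr01.
have he : ccvg (fun M => Gammat_partial x M.*2)
    (cexp (- x * (ln 2)%:C) * x * ((Num.sqrt pi)%:C * Gamma_half_ratio x)).
  have h1 := ccvgM (@ccvg_cexp R (- x) _ _ altharmonic_cvg) (@ccvg_cst R x).
  have h2 := ccvgM (altprod_cvg x0) (altprod_cvg x10).
  (* The products at x and at 1 each take a factor sqrt(M+1), so 2M + 1 is divided by M + 1. The
     limit 2 cancels the denominator of [Gamma_half_ratio 1], equal to sqrt(pi)/2. *)
  have h3 : ccvg (fun M => M.*2.+1%:R / M.+1%:R) (2 : R[i]).
    have := ccvgM (@ccvg_cst R 2) (ccvg_divS (- 2^-1 : R[i])).
    move=> h; apply: (ccvg_eq h); last by rewrite mulr1.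
    move=> M; have -> : M.*2.+1%:R = 2 * M.+1%:R - 1 :> R[i].
      by rewrite -[M.+1%:R]natr1 -addn1 natrD -muln2 natrM; ring.
    have : M.+1%:R != 0 :> R[i] by rewrite pnatr_eq0.
    by move: (M.+1%:R : R[i]) => N N0; field.
  apply: (ccvg_eq (ccvgM h1 (ccvgM h2 h3))).
    move=> M; rewrite Gammat_partial_even//.
    have : (Num.sqrt M.+1%:R)%:C ^+ 2 = M.+1%:R :> R[i].
      by rewrite -rmorphXn /= sqr_sqrtr// rmorph_nat.
    have : M.+1%:R != 0 :> R[i] by rewrite pnatr_eq0.
    move: (cexp _) (altprod M x) (altprod M 1) (M.*2.+1%:R : R[i]) (M.+1%:R : R[i])
      (Num.sqrt _)%:C => c A B N1 N s N0 sN.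
    transitivity (c * x * A * B * N1 * (s ^+ 2 / N)); first by field.
    by rewrite sN divff// mulr1; ring.
  rewrite Gamma_half_ratio1; congr (_ * _ * _).
  by field.
apply: ccvg_even_odd => //.
(* An odd truncation has one more factor, e^(-x/(2M+1)) (1 + x/(2M+1)), both parts of which tend to
   1. *)
have x1 : ccvg (fun M => cexp (- x * (M.*2.+1%:R^-1)%:C)) (cexp (- x * 0%:C)).
  apply: ccvg_cexp.
  apply: (@squeeze_cvgr _ _ _ _ (fun=> 0) (fun M => M.+1%:R^-1)).
  - near=> M; rewrite invr_ge0 ler0n /= lef_pV2 ?posrE// ler_nat ltnS -addnn leq_addr//.
  - exact: cvg_cst.
  - exact: cvg_harmonic.
have x2 := @ccvg_subseq R _ _ (fun M => M.*2) _ (ccvg_divS x).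
have x2' := x2 (fun M => leq_trans (leq_addr M M) (eq_leq (addnn M))).
apply: (ccvg_eq (ccvgM he (ccvgM x1 x2'))).
  move=> M; rewrite /Gammat_partial [RHS]big_nat_recr//= sign_double expr1z.
  by rewrite fmorphV rmorph_nat.
by rewrite mulr0 -[0]/(0%:C) cexp_real expR0 !mulr1.
Unshelve. all: by end_near. Qed.

Lemma GammatE x : 0 < complex.Re x ->
  Gammat x = (Num.sqrt pi)%:C * Gamma_half_ratio x.
Proof.
move=> x0; have x00 : x != 0 by have := addr_natr_neq0 0 x0; rewrite addr0.
rewrite /Gammat (cvg_lim (@norm_hausdorff _ R[i]^o) (Gammat_partial_cvg x0)).
rewrite mulNr cexpN; have := cexp_neq0 (x * (ln 2)%:C).
by move: (cexp _) => c c0; field; rewrite c0 x00.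
Qed.

(* With [n = 2 p + 1], the truncation of the product for [n x] at
   [M' = n M + p] splits into those for [x + j / n] at [M], and
   [(M' + 1) / (M + 1)] tends to [n]. *)
Lemma Gamma_half_ratio_mul x n : 0 < complex.Re x -> odd n ->
  Gamma_half_ratio (n%:R * x) = n%:R^-1 * (Num.sqrt n%:R)%:C *
    \prod_(0 <= j < n) Gamma_half_ratio (x + j%:R / n%:R) ^ ((-1) ^+ j : int).
Proof.
move=> x0 odn; pose p := n./2.
have nE : n = p.*2.+1 by rewrite -[LHS]odd_double_half odn.
have n0 : 0 < n%:R :> R by rewrite nE.
have xj j : 0 < complex.Re (x + j%:R / n%:R).
  rewrite -!(rmorph_nat (real_complex R)) -fmorphV -rmorphM /=.
  by case: x x0 => a b /= a0; rewrite ltr_wpDr// divr_ge0.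
have nx0 : 0 < complex.Re (n%:R * x).
  rewrite -(rmorph_nat (real_complex R)); case: x x0 {xj} => a b /= a0.
  by rewrite mul0r subr0 mulr_gt0.
have hM M : (M <= n * M + p)%N by rewrite nE; lia.
have h1 := ccvg_subseq hM (altprod_cvg nx0).
have hq : (Num.sqrt ((n * M + p).+1%:R / M.+1%:R) @[M --> \oo] --> (Num.sqrt n%:R : R))%classic.
  apply: continuous_cvg; first exact: sqrt_continuous.
  have e : n%:R = n%:R + (p.+1%:R - n%:R) * 0 :> R by rewrite mulr0 addr0.
  rewrite [X in (_ --> X)%classic]e.
  have -> : (fun M => (n * M + p).+1%:R / M.+1%:R) =
      (fun M => n%:R + (p.+1%:R - n%:R) * M.+1%:R^-1 :> R).
    apply/funext => M; have : M.+1%:R != 0 :> R by rewrite pnatr_eq0.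
    have -> : (n * M + p).+1%:R = n%:R * M.+1%:R + (p.+1%:R - n%:R) :> R.
      by rewrite -addnS natrD natrM -[M.+1%:R]natr1; ring.
    by move: (M.+1%:R : R) => N N0; field.
  apply: cvgD; first exact: cvg_cst.
  by apply: cvgM; [exact: cvg_cst|exact: cvg_harmonic].
have hz j : ccvg
    (fun M => ((Num.sqrt M.+1%:R)%:C * altprod M (x + j%:R / n%:R)) ^ ((-1) ^+ j : int))
    (Gamma_half_ratio (x + j%:R / n%:R) ^ ((-1) ^+ j : int)).
  have h := altprod_cvg (xj j).
  rewrite -signr_odd; case: (odd j); rewrite ?expr1 ?expr0.
    by apply: ccvgV => //; exact: Gamma_half_ratio_neq0.
  by [].
have h2 := ccvgM (ccvgM (@ccvg_cst R n%:R^-1) (ccvg_real hq)) (@ccvg_prod R n _ _ hz).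
apply: (ccvg_unique h1); apply: (ccvg_eq h2) => // M /=.
have s0 : (Num.sqrt M.+1%:R)%:C != 0 :> R[i].
  by rewrite -[0]/(0%:C) (inj_eq (@complexI _)) sqrtr_eq0 -ltNge.
under eq_bigr do rewrite expfzMl.
rewrite big_split /=.
(* Since n is odd, the alternating exponents add up to 1, so a single sqrt(M+1) survives. *)
rewrite [X in _ * (X * _) = _](prod_sign_odd s0 odn).
have := altprod_mul p M x; rewrite -nE /= => ->.
rewrite sqrtrM// sqrtrV// rmorphM fmorphV /=.
by field; rewrite s0 -(rmorph_nat (real_complex R)) -[0]/(0%:C) (inj_eq (@complexI _)) gt_eqF.
Qed.

End Gammat_limit.

(** * The two identities, from the closed form of the product *)

Unset Implicit Arguments.

Theorem theorem2p17 (R : realType) (x : R[i]) (hx : 0 < complex.Re x) :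
  Gammat (2%:R * x)
    = (Num.sqrt (pi : R) / 2%:R)%:C * (Gamma x / Gamma (x + 2%:R^-1))
  /\
  forall n : nat, odd n ->
    Gammat (n%:R * x)
    = ((Num.sqrt (n%:R : R))%:C)^-1
      * \prod_(0 <= j < n) Gammat (x + j%:R / n%:R) ^ ((-1) ^+ j : int).
Proof.
have pos n : (0 < n)%N -> 0 < complex.Re (n%:R * x).
  move=> n0; rewrite -(rmorph_nat (real_complex R)); case: x hx => a b /= a0.
  by rewrite mul0r subr0 mulr_gt0// ltr0n.
split.
  have e : 2 * x / 2 = x by field.
  rewrite GammatE ?pos// /Gamma_half_ratio e.
  by rewrite rmorphM fmorphV rmorph_nat /=; ring.
move=> n odn; have n0 : (0 < n)%N by rewrite odd_gt0.
have nE : n = n./2.*2.+1 by rewrite -[LHS]odd_double_half odn.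
have xj j : 0 < complex.Re (x + j%:R / n%:R).
  rewrite -!(rmorph_nat (real_complex R)) -fmorphV -rmorphM /=.
  by case: x hx {pos} => a b /= a0; rewrite ltr_wpDr// divr_ge0.
rewrite GammatE ?pos// Gamma_half_ratio_mul//.
under [in RHS]eq_bigr do rewrite GammatE// expfzMl.
rewrite big_split /=.
have p0 : (Num.sqrt (pi : R))%:C != 0 :> R[i].
  by rewrite -[0]/(0%:C) (inj_eq (@complexI _)) sqrtr_eq0 -ltNge pi_gt0.
(* For the same parity reason one factor sqrt(pi) remains, matching the one on the left. *)
rewrite [X in _ = _ * (X * _)](prod_sign_odd p0 odn).
have sn : (Num.sqrt n%:R)%:C ^+ 2 = n%:R :> R[i].
  by rewrite -rmorphXn /= sqr_sqrtr// rmorph_nat.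
have s0 : (Num.sqrt n%:R)%:C != 0 :> R[i].
  by rewrite -[0]/(0%:C) (inj_eq (@complexI _)) sqrtr_eq0 -ltNge ltr0n.
(* With n written as s^2, the constant n^-1 s becomes s^-1. *)
rewrite -{1}sn; move: (Num.sqrt n%:R)%:C s0 {sn} => s s0.
by field.
Qed.
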